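(* Let $n,m\ge 1$, and let $\mu$ be the moment map of the action of $Sp_{2n}$ on $(\mathbb{C}^{2n})^{\oplus 2m}$. Then the zero fibre $\mu^{-1}(0)$ is reduced if $m\ge 2n$, and it is even normal if $m\ge 2n+1$.
   Context: The base field is $\mathbb{C}$. $Sp_{2n}$ is the group of $g\in Gl_{2n}(\mathbb{C})$ with $g^tJg=J$, where $J=\begin{pmatrix} 0 & I_n \\ -I_n & 0 \end{pmatrix}$; let $Q=\begin{pmatrix} 0 & I_m \\ I_m & 0 \end{pmatrix}$. Elements of $(\mathbb{C}^{2n})^{\oplus 2m}$ are written as $2n\times 2m$ matrices $X$, with $Sp_{2n}$ acting by left multiplication. This is the symplectic double $V\oplus V^*$ of $V=(\mathbb{C}^{2n})^{\oplus m}$: writing $X=(X',X'')$ with $X',X''$ of size $2n\times m$, the matrix $X''$ corresponds to the linear form $Y\mapsto \operatorname{tr}((X'')^tJY)$ on $V$. The moment map of a symplectic double is $\mu\colon V\oplus V^*\to\mathfrak g^*$, $\mu(v,\eta)(A)=\eta(Av)$; here, after identifying $\mathfrak{sp}_{2n}^*$ with $\mathfrak{sp}_{2n}$ via the trace form, it is $\mu(X)=\tfrac12 XQX^tJ$. The zero fibre $\mu^{-1}(0)$ is the scheme $\operatorname{Spec}(\mathbb{C}[x_{ij}]/\mathcal I_\mu)$, where $\mathcal I_\mu$ is the ideal generated by the components of $\mu$, equivalently by the entries of the symmetric matrix $XQX^t$. *)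

(* Defs.v *)
From HB Require Import structures.
From mathcomp Require Import all_boot all_order all_algebra.
From mathcomp Require Import ring_quotient fraction mxpoly generic_quotient.
From mathcomp Require Import boolp reals complex.
From mathcomp Require Import mpoly ring.

Set Implicit Arguments.
Unset Strict Implicit.
Unset Printing Implicit Defensive.

Import GRing.Theory Quotient.

Local Open Scope ring_scope.
Local Open Scope quotient_scope.

Definition reduced_ring (A : nzRingType) : Prop :=
  forall (a : A) (k : nat), a ^+ k = 0 -> a = 0.

Definition integrally_closed (D : idomainType) : Prop :=
  forall z : {fraction D}, integralOver (@FracField.tofrac D) z ->
    exists a : D, z = FracField.tofrac a.

(* Stated up to isomorphism because an [idomainType] also carries a decision   *)
(* of invertibility and an inverse function, which [B] lacks.                  *)
Definition normal_domain (B : comNzRingType) : Prop :=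
  exists (D : idomainType) (f : {rmorphism B -> D}),
    bijective f /\ integrally_closed D.

(* The local ring A_p: fractions a/s with s outside p, where a/s = b/t when     *)
(* u (a t - b s) = 0 for some u outside p (A need not be a domain).             *)
Module Localization.
Section Localization.
Variables (A : comNzRingType) (p : prime_idealr A).

Definition frac := {x : A * A | x.2 \notin (p : {pred A})}.
Implicit Types x y z : frac.

Definition num x : A := (val x).1.
Definition den x : A := (val x).2.

Lemma denP x : den x \notin (p : {pred A}). Proof. exact: (valP x). Qed.

Lemma notinM u v : u \notin (p : {pred A}) -> v \notin (p : {pred A}) ->
  u * v \notin (p : {pred A}).
Proof. by rewrite prime_idealrM negb_or => -> ->. Qed.

Lemma notin1 : 1 \notin (p : {pred A}). Proof. by rewrite idealr1. Qed.

Definition mk (a s : A) (hs : s \notin (p : {pred A})) : frac :=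
  exist _ (a, s) hs.

Lemma num_mk a s hs : num (@mk a s hs) = a. Proof. by []. Qed.
Lemma den_mk a s hs : den (@mk a s hs) = s. Proof. by []. Qed.

Definition eqfrac x y : bool :=
  `[< exists2 u, u \notin (p : {pred A}) &
      u * (num x * den y - num y * den x) = 0 >].

Lemma eqfrac_refl : reflexive eqfrac.
Proof. by move=> x; apply/asboolP; exists 1; rewrite ?notin1 // subrr mulr0. Qed.

Lemma eqfrac_sym : ssrbool.symmetric eqfrac.
Proof.
move=> x y; apply/asboolP/asboolP => -[u pu e]; exists u => //;
  by rewrite -opprB mulrN e oppr0.
Qed.

Lemma eqfrac_trans : transitive eqfrac.
Proof.
move=> y x z /asboolP[u pu eu] /asboolP[v pv ev]; apply/asboolP.
exists (u * v * den y); first by rewrite !notinM ?denP.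
transitivity (v * den z * (u * (num x * den y - num y * den x))
  + u * den x * (v * (num y * den z - num z * den y))); first by ring.
by rewrite eu ev !mulr0 addr0.
Qed.

Canonical eqfrac_equiv := EquivRel eqfrac eqfrac_refl eqfrac_sym eqfrac_trans.

Definition type := {eq_quot eqfrac}.
HB.instance Definition _ : EqQuotient _ eqfrac type := EqQuotient.on type.
HB.instance Definition _ := Choice.on type.

Lemma piP x y : reflect
  (exists2 u, u \notin (p : {pred A}) &
     u * (num x * den y - num y * den x) = 0)
  (x == y %[mod type]).
Proof. by rewrite eqmodE; apply: asboolP. Qed.

Lemma eq_by x y : num x * den y = num y * den x -> x = y %[mod type].
Proof.
by move=> e; apply/eqP/piP; exists 1; rewrite ?notin1 // e subrr mulr0.
Qed.

Definition addf x y : frac :=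
  mk (num x * den y + num y * den x) (notinM (denP x) (denP y)).
Definition oppf x : frac := mk (- num x) (denP x).
Definition mulf x y : frac := mk (num x * num y) (notinM (denP x) (denP y)).
Definition fracA (a : A) : frac := mk a notin1.

Let fracE := (num_mk, den_mk).

Definition zero : type := lift_cst type (fracA 0).
Canonical pi_zero_morph := PiConst zero.
Definition one : type := lift_cst type (fracA 1).
Canonical pi_one_morph := PiConst one.

Lemma reprP x : exists2 u, u \notin (p : {pred A}) &
  u * (num x * den (repr (\pi_type x)) - num (repr (\pi_type x)) * den x) = 0.
Proof. by apply/piP; rewrite reprK. Qed.

Definition add := lift_op2 type addf.
Lemma pi_add : {morph \pi : x y / addf x y >-> add x y}.
Proof.
move=> x y; unlock add; apply/eqP/piP.
have [u pu eu] := reprP x; have [v pv ev] := reprP y.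
move: (repr (\pi x)) (repr (\pi y)) eu ev => x' y' eu ev.
exists (u * v); first exact: notinM.
rewrite !fracE.
transitivity (v * den y * den y' * (u * (num x * den x' - num x' * den x))
  + u * den x * den x' * (v * (num y * den y' - num y' * den y))); first by ring.
by rewrite eu ev !mulr0 addr0.
Qed.
Canonical pi_add_morph := PiMorph2 pi_add.

Definition opp := lift_op1 type oppf.
Lemma pi_opp : {morph \pi : x / oppf x >-> opp x}.
Proof.
move=> x; unlock opp; apply/eqP/piP.
have [u pu eu] := reprP x; move: (repr _) eu => x' eu.
exists u => //; rewrite !fracE.
transitivity (- (u * (num x * den x' - num x' * den x))); first by ring.
by rewrite eu oppr0.
Qed.
Canonical pi_opp_morph := PiMorph1 pi_opp.

Definition mul := lift_op2 type mulf.
Lemma pi_mul : {morph \pi : x y / mulf x y >-> mul x y}.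
Proof.
move=> x y; unlock mul; apply/eqP/piP.
have [u pu eu] := reprP x; have [v pv ev] := reprP y.
move: (repr (\pi x)) (repr (\pi y)) eu ev => x' y' eu ev.
exists (u * v); first exact: notinM.
rewrite !fracE.
transitivity (v * num y * den y' * (u * (num x * den x' - num x' * den x))
  + u * num x' * den x * (v * (num y * den y' - num y' * den y))); first by ring.
by rewrite eu ev !mulr0 addr0.
Qed.
Canonical pi_mul_morph := PiMorph2 pi_mul.

Lemma addA : associative add.
Proof.
elim/quotW=> x; elim/quotW=> y; elim/quotW=> z; rewrite !piE; apply: eq_by.
by rewrite !fracE; ring.
Qed.

Lemma addC : commutative add.
Proof.
elim/quotW=> x; elim/quotW=> y; rewrite !piE; apply: eq_by.
by rewrite !fracE; ring.
Qed.

Lemma add0 : left_id zero add.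
Proof.
by elim/quotW=> x; rewrite !piE; apply: eq_by; rewrite !fracE; ring.
Qed.

Lemma addN : left_inverse zero opp add.
Proof.
by elim/quotW=> x; rewrite !piE; apply: eq_by; rewrite !fracE; ring.
Qed.

HB.instance Definition _ := GRing.isZmodule.Build type addA addC add0 addN.

Lemma mulA : associative mul.
Proof.
elim/quotW=> x; elim/quotW=> y; elim/quotW=> z; rewrite !piE; apply: eq_by.
by rewrite !fracE; ring.
Qed.

Lemma mulC : commutative mul.
Proof.
elim/quotW=> x; elim/quotW=> y; rewrite !piE; apply: eq_by.
by rewrite !fracE; ring.
Qed.

Lemma mul1 : left_id one mul.
Proof.
by elim/quotW=> x; rewrite !piE; apply: eq_by; rewrite !fracE; ring.
Qed.

Lemma mulDl : left_distributive mul add.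
Proof.
elim/quotW=> x; elim/quotW=> y; elim/quotW=> z; rewrite !piE; apply: eq_by.
by rewrite !fracE; ring.
Qed.

Lemma one_neq0 : one != zero.
Proof.
apply/negP; rewrite !piE => /asboolP[u pu].
rewrite !fracE !mulr1 subr0 mulr1 => u0.
by rewrite u0 rpred0 in pu.
Qed.

HB.instance Definition _ :=
  GRing.Zmodule_isComNzRing.Build type mulA mulC mul1 mulDl one_neq0.

End Localization.
End Localization.
HB.export Localization.

Notation localization := Localization.type.

(* Normality of Spec A: all local rings are integrally closed domains. *)
Definition normal_spec (A : comNzRingType) : Prop :=
  forall p : prime_idealr A, normal_domain (localization p).

Definition ideal_gen (S : comNzRingType) (G : S -> Prop) (f : S) : Prop :=
  exists s : seq (S * S),
    (forall q, q \in s -> G q.2) /\ f = \sum_(q <- s) q.1 * q.2.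

Section IdealGen.
Variables (S : comNzRingType) (G : S -> Prop).

Lemma ideal_gen_mem g : G g -> ideal_gen G g.
Proof.
move=> Gg; exists [:: (1, g)]; rewrite big_seq1 mul1r; split => // q.
by rewrite inE => /eqP->.
Qed.

Lemma ideal_gen0 : ideal_gen G 0.
Proof. by exists [::]; rewrite big_nil. Qed.

Lemma ideal_genD f g : ideal_gen G f -> ideal_gen G g -> ideal_gen G (f + g).
Proof.
move=> [s [Gs ->]] [t [Gt ->]]; exists (s ++ t); rewrite big_cat; split => // q.
by rewrite mem_cat => /orP[/Gs|/Gt].
Qed.

Lemma ideal_genMl a f : ideal_gen G f -> ideal_gen G (a * f).
Proof.
move=> [s [Gs ->]]; exists [seq (a * q.1, q.2) | q <- s]; split.
  by move=> _ /mapP[q /Gs Gq ->].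
by rewrite big_map mulr_sumr; apply: eq_bigr => q _; rewrite mulrA.
Qed.

Lemma ideal_gen_sum I (r : seq I) (P : pred I) (f : I -> S) :
  (forall i, P i -> ideal_gen G (f i)) -> ideal_gen G (\sum_(i <- r | P i) f i).
Proof. by move=> Gf; apply: big_ind => //; [exact: ideal_gen0|exact: ideal_genD]. Qed.

End IdealGen.

Lemma ideal_gen_min (S : comNzRingType) (G G' : S -> Prop) f :
  (forall g, G g -> ideal_gen G' g) -> ideal_gen G f -> ideal_gen G' f.
Proof.
move=> GG' [s [Gs ->]]; rewrite big_seq.
have G's q : q \in s -> ideal_gen G' q.2 by move=> /Gs/GG'.
apply: big_ind => [|f1 f2|q /G's]; first exact: ideal_gen0.
  exact: ideal_genD.
exact: ideal_genMl.
Qed.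

Section SymplecticDouble.
Variables (n m : nat).

Definition symplJ (S : pzRingType) : 'M[S]_(n + n) :=
  block_mx 0 1%:M (- 1%:M) 0.

Definition symQ (S : pzRingType) : 'M[S]_(m + m) :=
  block_mx 0 1%:M 1%:M 0.

(* The Lie algebra sp_2n of the group of all g such that g^T J g = J. *)
Definition sp_lie (S : pzRingType) : {pred 'M[S]_(n + n)} :=
  [pred A | A^T *m symplJ S + symplJ S *m A == 0].

(* The element of V^* given by X'', where V is the space of 2n x m matrices. *)
Definition dual_form (S : pzRingType) (X2 Y : 'M[S]_(n + n, m)) : S :=
  \tr (X2^T *m symplJ S *m Y).

(* mu(v, eta)(A) = eta(A v) for v = X' and eta the linear form of X''. *)
Definition moment (S : pzRingType) (X : 'M[S]_(n + n, m + m))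
    (A : 'M[S]_(n + n)) : S :=
  dual_form (rsubmx X) (A *m lsubmx X).

Lemma symplJ_tr (S : pzRingType) : (symplJ S)^T = - symplJ S.
Proof.
by rewrite tr_block_mx !trmx0 trmx1 linearN /= trmx1 opp_block_mx !oppr0 opprK.
Qed.

Lemma symplJ_sqr (S : pzRingType) : symplJ S *m symplJ S = - 1%:M.
Proof.
rewrite mulmx_block !mul0mx !mulmx0 mul1mx mulmx1 !addr0 !add0r.
by rewrite [in RHS]scalar_mx_block opp_block_mx oppr0.
Qed.

Lemma mulmx_symQ (S : pzRingType) (X : 'M[S]_(n + n, m + m)) :
  X *m symQ S *m X^T = rsubmx X *m (lsubmx X)^T + lsubmx X *m (rsubmx X)^T.
Proof.
rewrite -[in LHS](hsubmxK X) tr_row_mx mul_row_block !mulmx0 !mulmx1 add0r addr0.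
by rewrite mul_row_col.
Qed.

(* Under the trace form, mu(X) is the matrix 1/2 X Q X^T J. *)
Lemma moment_trace (S : comPzRingType) (X : 'M[S]_(n + n, m + m)) A :
  A \in @sp_lie S -> moment X A *+ 2 = \tr (X *m symQ S *m X^T *m symplJ S *m A).
Proof.
rewrite inE addr_eq0 => /eqP AJ; rewrite mulmx_symQ mulmxDl mulmxDl raddfD /=.
rewrite mulr2n /moment /dual_form; congr (_ + _); last first.
  by rewrite -!mulmxA [RHS]mxtrace_mulC -!mulmxA.
rewrite -[RHS]mxtrace_tr !trmx_mul trmxK symplJ_tr mulNmx mulmxN (mulmxA A^T) AJ.
by rewrite mulNmx opprK -mulmxA [LHS]mxtrace_mulC -!mulmxA.
Qed.

Section ZeroFibre.
Variable F : fieldType.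

Definition coord_ring := {mpoly F[(n + n) * (m + m)]}.

Definition generic_mx : 'M[coord_ring]_(n + n, m + m) :=
  \matrix_(i, j) 'X_(mxvec_index i j).

(* The component of mu at A in sp_2n, as a polynomial function on V + V^*. *)
Definition moment_comp (A : 'M[F]_(n + n)) : coord_ring :=
  moment generic_mx (map_mx (@mpolyC _ F) A).

Definition moment_ideal : {pred coord_ring} := fun f =>
  `[< ideal_gen (fun g => exists2 A, A \in @sp_lie F & g = moment_comp A) f >].

Lemma meval0_moment_comp A : (moment_comp A).@[fun=> 0] = 0.
Proof.
rewrite /moment_comp /moment /dual_form -[LHS]trace_map_mx !map_mxM /=.
have -> : map_mx (meval (fun=> 0)) (lsubmx generic_mx) = 0.
  by apply/matrixP => i j; rewrite !mxE mevalXU.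
by rewrite !mulmx0 raddf0.
Qed.

Lemma moment_idealr_closed : idealr_closed moment_ideal.
Proof.
split=> [||a u v /asboolP Iu /asboolP Iv].
- by apply/asboolP; apply: ideal_gen0.
- apply/asboolP => -[s [Gs /(congr1 (meval (fun=> 0)))/eqP]].
  rewrite rmorph1 rmorph_sum big_seq big1 ?oner_eq0 // => q /Gs[A _ ->].
  by rewrite rmorphM /= meval0_moment_comp mulr0.
- by apply/asboolP; apply: ideal_genD => //; apply: ideal_genMl.
Qed.

HB.instance Definition _ :=
  isIdealr.Build coord_ring moment_ideal moment_idealr_closed.

(* The coordinate ring of the scheme mu^{-1}(0). *)
Definition zero_fibre := {ideal_quot moment_ideal}.
HB.instance Definition _ := GRing.ComNzRing.on zero_fibre.

Lemma map_symplJ (S T : pzRingType) (f : {rmorphism S -> T}) :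
  map_mx f (symplJ S) = symplJ T.
Proof.
by rewrite map_block_mx !raddf0 map_mx1 raddfN /= map_mx1.
Qed.

Lemma moment_ideal_entries (f : coord_ring) :
  (2 != 0 :> F) ->
  (f \in moment_ideal) <->
  ideal_gen (fun g => exists i j,
    g = (generic_mx *m symQ coord_ring *m generic_mx^T) i j) f.
Proof.
move=> F2; set M := _ *m _ *m _; split => [/asboolP|If]; [|apply/asboolP; move: If];
  apply: ideal_gen_min => g.
- case=> A spA ->; have spA' : map_mx (@mpolyC ((n + n) * (m + m))%N F) A \in @sp_lie coord_ring.
    move: spA; rewrite !inE => /eqP /(congr1 (map_mx (@mpolyC ((n + n) * (m + m))%N F))).
    by rewrite map_mxD !map_mxM /= map_trmx map_symplJ raddf0 => ->.
  have F2V : (2^-1 : F) *+ 2 = 1 by rewrite -[LHS]mulr_natr mulVf.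
  have -> : moment_comp A =
      (2^-1 : F)%:MP * \tr (M *m symplJ _ *m map_mx (@mpolyC ((n + n) * (m + m))%N F) A).
    rewrite -moment_trace // mulrnAr -mulrnAl -raddfMn /= F2V.
    by rewrite mul1r.
  apply: ideal_genMl; rewrite -mulmxA /mxtrace; apply: ideal_gen_sum => i _.
  rewrite mxE; apply: ideal_gen_sum => j _; rewrite mulrC; apply: ideal_genMl.
  by apply: ideal_gen_mem; exists i, j.
- case=> i [j ->]; apply: ideal_gen_mem.
  pose E : 'M[F]_(n + n) := delta_mx i j + delta_mx j i.
  have ET : E^T = E by rewrite raddfD /= !trmx_delta addrC.
  have JJE : symplJ F *m - (symplJ F *m E) = E.
    by rewrite mulmxN mulmxA symplJ_sqr mulNmx mul1mx opprK.
  exists (- (symplJ F *m E)).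
    rewrite inE JJE raddfN /= trmx_mul ET symplJ_tr mulmxN opprK -mulmxA.
    by rewrite symplJ_sqr mulmxN mulmx1 addNr.
  rewrite /moment_comp /moment /dual_form mulmxA -[_ *m symplJ _ *m _]mulmxA.
  rewrite -(map_symplJ (@mpolyC ((n + n) * (m + m))%N F)) -map_mxM JJE.
  rewrite -mulmxA mxtrace_mulC -mulmxA.
  rewrite /M mulmx_symQ map_mxD !map_delta_mx.
  set P := lsubmx _ *m _; have <- : P^T = rsubmx generic_mx *m (lsubmx generic_mx)^T.
    by rewrite trmx_mul trmxK.
  have trE k l : \tr (delta_mx k l *m P) = P l k.
    rewrite -(mul_delta_mx (0 : 'I_1)) -mulmxA mxtrace_mulC -rowE -colE.
    by rewrite [LHS]trace_mx11 !mxE.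
  by rewrite mulmxDl raddfD /= !trE !mxE.
Qed.

End ZeroFibre.
End SymplecticDouble.

(* Main.v *)
(* Write N = 2n and let y_ik, z_ik be the entries of the two blocks of X.      *)
(* Up to a factor 2 the entries of X Q X^t with i <= j are                     *)
(*     g_ij = \sum_k y_ik z_jk + [i < j] \sum_k y_jk z_ik.                     *)
(* For a suitable weight the monomial y_ik z_jk with k = j - i (indices start  *)
(* at 0) is the unique heaviest one of g_ij; this needs m >= N. These leading  *)
(* monomials are squarefree and pairwise coprime, so the g_ij are a Groebner   *)
(* basis of a radical ideal.                                                  *)
(* If m > N, for a second weight the heaviest part of g_ij is the binomial     *)
(* y_ik z_jk + y_i(k+1) z_j(k+1) with k = j - i. The ring modulo these         *)
(* binomials is a semigroup ring: every class modulo the lattice they span     *)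
(* contains exactly one vector v such that for each i <= j the lesser of its   *)
(* entries at y_ik and z_jk is 0, and the class comes from a monomial iff      *)
(* v >= 0. As v is homogeneous in the class, the semigroup is saturated.       *)
(* Leading exponents in the semigroup ring define a valuation on the           *)
(* coordinate ring, which is thus a completely integrally closed domain; and   *)
(* integral closedness passes to the local rings.                             *)
From HB Require Import structures.
Require Import Defs.
From mathcomp Require Import all_boot all_order all_algebra.
From mathcomp Require Import ring_quotient fraction generic_quotient.
From mathcomp Require Import boolp reals complex.
From mathcomp Require Import mpoly ring zify.

Set Implicit Arguments.
Unset Strict Implicit.
Unset Printing Implicit Defensive.

Import Order.TTheory GRing.Theory.

Local Open Scope ring_scope.
Local Open Scope quotient_scope.

(** Since 2 is invertible, the moment ideal is generated by the polynomials [frame_gen]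
    ([moment_idealE]), and two degenerations of it are used. If m >= 2n, the weight [w] selects
    pairwise coprime leading monomials, which forces a Groebner basis ([groebner_lead], by induction
    on the list of generators instead of S-pairs). As they are squarefree, a polynomial in standard
    monomials with a power in the ideal is 0 ([squarefree_radical]).

    If m > 2n, the weight [D] degenerates the ring to a semigroup ring, realised by monomials with
    exponents [key u]. Standard monomials have distinct keys ([key_inj_standard]), and reduction to
    them preserves the top degree ([normal_form]), so the leading key is an additive valuation and
    the ring is a domain ([toric_prime]). If b^k divides x a^k for all k, with b and x nonzero, then
    [key_saturated] makes the leading key of a divisible by that of b, and repeated division
    exhausts a ([toric_almost_integral]). Integral fractions are almost integral
    ([almost_integral_divides]), and integral closedness descends to the local rings
    ([loc_normal_domain]). *)

(** * Groebner bases with coprime leading monomials *)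

Section MonomialSubst.
Variables (n k : nat) (K : fieldType) (c : 'I_n -> K) (ka : 'I_n -> 'X_{1..k}).

Definition mexp (u : 'X_{1..n}) : 'X_{1..k} := (\sum_(i < n) ka i *+ u i)%MM.

Definition mscal (u : 'X_{1..n}) : K := \prod_(i < n) c i ^+ u i.

(** Used twice: with X_i sent to X_i^(w i), to make the monomial order see weights, and with signs,
    to map onto a semigroup ring where the binomials vanish. *)
Definition msubst (f : {mpoly K[n]}) : {mpoly K[k]} :=
  f \mPo [tuple c i *: 'X_[ka i] | i < n].

HB.instance Definition _ := GRing.RMorphism.copy msubst
  (comp_mpoly [tuple c i *: 'X_[ka i] | i < n]).

Lemma msubstZ a f : msubst (a *: f) = a *: msubst f.
Proof. exact: comp_mpolyZ. Qed.

Lemma mexpE u j : mexp u j = (\sum_(i < n) ka i j * u i)%N.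
Proof. by rewrite mnm_sumE; apply: eq_bigr => i _; rewrite mulmnE. Qed.

Lemma mexpD u v : mexp (u + v)%MM = (mexp u + mexp v)%MM.
Proof.
apply/mnmP => j; rewrite mnmDE !mexpE -big_split; apply: eq_bigr => i _ /=.
by rewrite mnmDE mulnDr.
Qed.

Lemma mexpMn u l : mexp (u *+ l)%MM = (mexp u *+ l)%MM.
Proof.
apply/mnmP => j; rewrite mulmnE !mexpE big_distrl /=; apply: eq_bigr => i _.
by rewrite mulmnE mulnA.
Qed.

Lemma mscalD u v : mscal (u + v)%MM = mscal u * mscal v.
Proof.
by rewrite /mscal -big_split; apply: eq_bigr => i _ /=; rewrite mnmDE exprD.
Qed.

Lemma mscalU i : mscal U_(i)%MM = c i.
Proof.
rewrite /mscal (bigD1 i) //= mnm1E eqxx expr1 big1 ?mulr1 //.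
by move=> l li; rewrite mnm1E eq_sym (negPf li) expr0.
Qed.

Lemma msubstX u : msubst 'X_[u] = mscal u *: 'X_[mexp u].
Proof.
rewrite /msubst comp_mpolyX /mscal /mexp -mprodXnE -scaler_prod.
by apply: eq_bigr => i _; rewrite tnth_mktuple exprZn.
Qed.

Lemma msubstE f :
  msubst f = \sum_(u <- msupp f) (f@_u * mscal u) *: 'X_[mexp u].
Proof.
rewrite {1}(mpolyE f) raddf_sum; apply: eq_bigr => u _.
by rewrite -[LHS]/(msubst _) msubstZ msubstX scalerA.
Qed.

Lemma msupp_msubst f m : m \in msupp (msubst f) ->
  exists2 u, u \in msupp f & m = mexp u.
Proof.
rewrite msubstE => /msupp_sum_le; case/flatten_mapP => u.
rewrite filter_predT => fu /msuppZ_le /mem_msuppXP <-; by exists u.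
Qed.

Section InjectiveOnSupport.
Variable f : {mpoly K[n]}.
Hypotheses (c_neq0 : forall i, c i != 0) (inj : {in msupp f &, injective mexp}).

Lemma mscal_neq0 u : mscal u != 0.
Proof. by apply/prodf_neq0 => i _; rewrite expf_neq0. Qed.

Lemma mcoeff_msubst u : u \in msupp f -> (msubst f)@_(mexp u) = f@_u * mscal u.
Proof.
move=> fu; rewrite msubstE raddf_sum /= (bigD1_seq u) ?msupp_uniq //=.
rewrite mcoeffZ mcoeffX eqxx mulr1 big_seq_cond big1 ?addr0 // => v /andP[fv vu].
rewrite mcoeffZ mcoeffX; case: eqP => [/(inj fv fu) e|]; last by rewrite mulr0.
by rewrite e eqxx in vu.
Qed.

Lemma mexp_msupp u : u \in msupp f -> mexp u \in msupp (msubst f).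
Proof.
by move=> fu; rewrite mcoeff_msupp mcoeff_msubst // mulf_neq0 ?mscal_neq0 // -mcoeff_msupp.
Qed.

Lemma msubst_neq0 : f != 0 -> msubst f != 0.
Proof.
move=> /mlead_supp/mexp_msupp; apply: contraTneq => ->.
by rewrite msupp0.
Qed.

Lemma mlead_msubst : f != 0 ->
  exists2 u, u \in msupp f & mlead (msubst f) = mexp u.
Proof. by move=> /msubst_neq0/mlead_supp/msupp_msubst. Qed.

End InjectiveOnSupport.

End MonomialSubst.

Section Reduction.
Variables (n : nat) (K : fieldType) (wt : 'X_{1..n} -> nat).
Variables (bad D : pred 'X_{1..n}) (Z : {mpoly K[n]} -> Prop).
Hypotheses (Z0 : Z 0) (ZD : forall f g, Z f -> Z g -> Z (f + g))
  (ZZ : forall a f, Z f -> Z (a *: f)).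
Hypothesis step : forall u, D u -> bad u ->
  exists2 z, Z z & forall v, v \in msupp ('X_[u] - z) -> D v /\ (wt v < wt u)%N.

Lemma reduce_terms (Q : 'X_{1..n} -> Prop) f :
  (forall u, u \in msupp f ->
     exists2 z, Z z & forall v, v \in msupp ('X_[u] - z) -> Q v) ->
  exists2 z, Z z & forall v, v \in msupp (f - z) -> Q v.
Proof.
rewrite {2}(mpolyE f); elim: (msupp f) => [|u s IH] sP.
  by exists 0 => // v; rewrite big_nil subr0 msupp0.
have [v vs|z1 Zz1 z1P] := IH; first by apply: sP; rewrite inE vs orbT.
have [z2 Zz2 z2P] := sP u (mem_head _ _).
exists (f@_u *: z2 + z1); first by apply: ZD => //; apply: ZZ.
move=> v; rewrite big_cons opprD addrACA -scalerBr => /msuppD_le.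
by rewrite mem_cat => /orP[/msuppZ_le/z2P|/z1P].
Qed.

(** Rewriting terminates because [wt] drops. The invariant [D] carries a degree bound through the
    rewriting in [normal_form]. *)
Lemma reduction f : (forall u, u \in msupp f -> D u) ->
  exists2 z, Z z & forall u, u \in msupp (f - z) -> D u /\ ~~ bad u.
Proof.
move=> fD; apply: reduce_terms => u /fD.
have [k] := ubnP (wt u); elim: k u => // k IH u; rewrite ltnS => uk Du.
have [bu|bu] := boolP (bad u); last first.
  by exists 0 => // v; rewrite subr0 => /mem_msuppXP <-.
have [z Zz zP] := step Du bu.
have [v /zP[Dv /leq_trans/(_ uk) vk]|z' Zz' z'P] := @reduce_terms (fun v => D v /\ ~~ bad v) ('X_[u] - z).
  exact: IH.
by exists (z + z'); [exact: ZD|rewrite opprD addrA].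
Qed.

End Reduction.

Section GeneratedIdeal.
Variables (n : nat) (K : fieldType).
Implicit Types (B : seq ('X_{1..n} * {mpoly K[n]})) (f g : {mpoly K[n]}).

(* The ideal generated by the second components of [B]; the first components  *)
(* are the intended leading monomials.                                        *)
Fixpoint in_ideal B f : Prop :=
  if B is b :: B' then exists h, in_ideal B' (f - h * b.2) else f = 0.

Lemma in_ideal0 B : in_ideal B 0.
Proof. by elim: B => //= b B IH; exists 0; rewrite mul0r subr0. Qed.

Lemma in_idealD B f g : in_ideal B f -> in_ideal B g -> in_ideal B (f + g).
Proof.
elim: B f g => [|b B IH] f g /=; first by move=> -> ->; rewrite addr0.
by move=> [h fh] [k gk]; exists (h + k); rewrite mulrDl opprD addrACA; exact: IH.
Qed.

Lemma in_idealMl B a f : in_ideal B f -> in_ideal B (a * f).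
Proof.
elim: B f => [|b B IH] f /=; first by move=> ->; rewrite mulr0.
by move=> [h fh]; exists (a * h); rewrite -mulrA -mulrBr; exact: IH.
Qed.

Lemma in_idealMr B a f : in_ideal B f -> in_ideal B (f * a).
Proof. by rewrite mulrC; apply: in_idealMl. Qed.

Lemma in_idealZ B a f : in_ideal B f -> in_ideal B (a *: f).
Proof. by rewrite -mul_mpolyC; apply: in_idealMl. Qed.

Lemma in_idealN B f : in_ideal B f -> in_ideal B (- f).
Proof. by rewrite -mulN1r; apply: in_idealMl. Qed.

Lemma in_idealB B f g : in_ideal B f -> in_ideal B g -> in_ideal B (f - g).
Proof. by move=> fB gB; apply: in_idealD => //; exact: in_idealN. Qed.

Lemma in_ideal_mem B b : b \in B -> in_ideal B b.2.
Proof.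
elim: B => //= b' B IH; rewrite inE => /predU1P[<-|/IH bB].
  by exists 1; rewrite mul1r subrr; exact: in_ideal0.
by exists 0; rewrite mul0r subr0.
Qed.

Definition standard B u := all (fun b => ~~ (b.1 <= u)%MM) B.

Lemma standardPn B u :
  reflect (exists2 b, b \in B & (b.1 <= u)%MM) (~~ standard B u).
Proof.
by rewrite -has_predC; apply: (iffP hasP) => -[b bB] /=;
  rewrite ?negbK => bu; exists b; rewrite //= ?negbK.
Qed.

Definition std_supp B f := forall u, u \in msupp f -> standard B u.

Lemma std_suppB B a f g : std_supp B f -> std_supp B g -> std_supp B (f - a *: g).
Proof.
move=> fB gB u /msuppB_le; rewrite mem_cat => /orP[/fB //|/msuppZ_le/gB //].
Qed.

End GeneratedIdeal.

Definition wdeg n (w : 'I_n -> nat) (u : 'X_{1..n}) : nat :=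
  (\sum_(i < n) w i * u i)%N.

Lemma wdegD n (w : 'I_n -> nat) u v : wdeg w (u + v)%MM = (wdeg w u + wdeg w v)%N.
Proof.
by rewrite /wdeg -big_split; apply: eq_bigr => i _; rewrite mnmDE mulnDr.
Qed.

Lemma wdegU n (w : 'I_n -> nat) i : wdeg w U_(i)%MM = w i.
Proof.
rewrite /wdeg (bigD1 i) //= mnm1E eqxx muln1 big1 ?addn0 //.
by move=> l li; rewrite mnm1E eq_sym (negPf li) muln0.
Qed.

Section Groebner.
Variables (n : nat) (K : fieldType) (w : 'I_n -> nat).
Implicit Types (B : seq ('X_{1..n} * {mpoly K[n]})) (f g : {mpoly K[n]}).
Implicit Type b : ('X_{1..n} * {mpoly K[n]})%type.
Hypothesis w_gt0 : forall i, (0 < w i)%N.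

Definition has_lead b := exists2 r, b.2 = 'X_[b.1] + r &
  forall v, v \in msupp r -> (wdeg w v < wdeg w b.1)%N.

Lemma has_lead_pairs (p0 : 'I_n * 'I_n) (r : seq ('I_n * 'I_n)) g :
    g = 'X_(p0.1) * 'X_(p0.2) + \sum_(p <- r) 'X_(p.1) * 'X_(p.2) ->
    (forall p, p \in r -> (w p.1 + w p.2 < w p0.1 + w p0.2)%N) ->
  has_lead ((U_(p0.1) + U_(p0.2))%MM, g).
Proof.
move=> gE rP; exists (\sum_(p <- r) 'X_(p.1) * 'X_(p.2)); first by rewrite mpolyXD.
move=> v /msupp_sum_le/flatten_mapP[p]; rewrite filter_predT => /rP.
by rewrite -mpolyXD => lt /mem_msuppXP <-; rewrite !wdegD !wdegU.
Qed.

Definition coprime_mnm (l l' : 'X_{1..n}) := [forall i, (l i == 0%N) || (l' i == 0%N)].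

Lemma coprime_mnm_le l l' u :
  coprime_mnm l l' -> (l' <= u + l)%MM -> (l' <= u)%MM.
Proof.
move=> /forallP co /mnm_lepP le; apply/mnm_lepP => i.
by have := le i; rewrite mnmDE; have /orP[/eqP->|/eqP->] := co i; rewrite ?addn0.
Qed.

Lemma ideal_reduction B f : (forall b, b \in B -> has_lead b) ->
  exists2 z, in_ideal B z & std_supp B (f - z).
Proof.
move=> leadB.
have [||u _ /standardPn[b bB bu]||z Bz zP] := @reduction n K (wdeg w)
  (fun u => ~~ standard B u) predT (in_ideal B) (in_ideal0 B) _ _ _ f => //.
- by move=> *; apply: in_idealD.
- by move=> *; apply: in_idealZ.
- exists ('X_[u - b.1] * b.2); first exact/in_idealMl/in_ideal_mem.
  have [r -> rP] := leadB b bB; rewrite mulrDr -mpolyXD submK // opprD addNKr.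
  move=> v; rewrite (perm_mem (msuppN _)) => /msuppM_le/allpairsP[[x y] /= []].
  move=> /mem_msuppXP <- /rP yb ->; split => //.
  by rewrite -{2}(submK bu) !wdegD ltn_add2l.
- by exists z => // u /zP[_]; rewrite negbK.
Qed.

(* Substituting X_i^(w i) for X_i turns the library's degree-first monomial    *)
(* order into one that compares [wdeg w] first.                               *)
Let pows (i : 'I_n) : 'X_{1..n} := (U_(i) *+ w i)%MM.
Let key := mexp pows.
Local Notation psi := (msubst (fun=> 1 : K) pows).

Let keyE u i : key u i = (w i * u i)%N.
Proof.
rewrite mexpE (bigD1 i) //= mulmnE mnm1E eqxx mul1n big1 ?addn0 //.
by move=> l li; rewrite mulmnE mnm1E (negPf li).
Qed.

Let key_inj : injective key.
Proof.
move=> u v /mnmP uv; apply/mnmP => i; have := uv i; rewrite !keyE => /eqP.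
by rewrite eqn_pmul2l // => /eqP.
Qed.

Let mdeg_key u : mdeg (key u) = wdeg w u.
Proof. by rewrite mdegE; apply: eq_bigr => i _; rewrite keyE. Qed.

Let psi_neq0 f : f != 0 -> psi f != 0.
Proof. by apply: msubst_neq0 => [i|]; [exact: oner_neq0|move=> u v _ _;
  exact: key_inj]. Qed.

Let mlead_psi f : f != 0 -> exists2 u, u \in msupp f & mlead (psi f) = key u.
Proof. by apply: mlead_msubst => [i|]; [exact: oner_neq0|move=> u v _ _;
  exact: key_inj]. Qed.

Let mlead_psi_gen b : has_lead b -> b.2 != 0 /\ mlead (psi b.2) = key b.1.
Proof.
move=> [r -> rP].
have psiX : psi 'X_[b.1] = 'X_[key b.1].
  by rewrite msubstX /mscal big1 ?scale1r // => i _; rewrite expr1n.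
have [->|r0] := eqVneq r 0.
  by rewrite addr0 psiX mleadXm -msupp_eq0 msuppX.
have lead : mlead (psi ('X_[b.1] + r)) = key b.1.
  rewrite rmorphD /= psiX mleadDl ?mleadXm //.
  have [v /rP vb ->] := mlead_psi r0.
  by apply: lt_mdeg_ltmc; rewrite !mdeg_key.
split => //; apply/negP => /eqP e; move: lead.
rewrite e raddf0 mlead0 => /(congr1 mdeg); rewrite mdeg0 mdeg_key => b0.
by have [v /rP] := mlead_psi r0; rewrite -b0.
Qed.

(** Write f = h b + (element of the ideal of the other generators) and reduce h modulo these. A
    leading monomial v of the reduced h is standard for them, and by coprimality so is v + b.1. If u
    were standard, it would differ from v + b.1, so nothing cancels in f - h b, whose leading
    monomial is then standard for the others, against induction. *)
Lemma groebner_lead B f u :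
    (forall b, b \in B -> has_lead b) ->
    pairwise (fun b b' => coprime_mnm b.1 b'.1) B ->
  in_ideal B f -> f != 0 -> mlead (psi f) = key u -> ~~ standard B u.
Proof.
elim: B f u => [|b B IH] f u leadB /=; first by move=> _ ->; rewrite eqxx.
move=> /andP[/allP/= co pw] [h fh] f0 fu; apply/negP => /andP[bu stdu].
have leadB' b' : b' \in B -> has_lead b'.
  by move=> b'B; apply: leadB; rewrite inE b'B orbT.
have [b0 bl] := mlead_psi_gen (leadB b (mem_head _ _)).
have [z Bz hz] := ideal_reduction h leadB'.
set h' := h - z in hz; have Bg : in_ideal B (f - h' * b.2).
  by rewrite /h' mulrBl opprB addrA addrAC; apply: in_idealD => //; exact: in_idealMr.
have [h0|h0] := eqVneq h' 0.
  by move: Bg; rewrite h0 mul0r subr0 => Bf; have := IH _ _ leadB' pw Bf f0 fu;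
    rewrite stdu.
have [v hv hl] := mlead_psi h0.
have hbl : mlead (psi (- (h' * b.2))) = key (v + b.1)%MM.
  by rewrite rmorphN rmorphM /= mleadN mleadM ?psi_neq0 // hl bl -mexpD.
have neq : mlead (psi f) != mlead (psi (- (h' * b.2))).
  by rewrite fu hbl (inj_eq key_inj); apply: contraNneq bu => ->; exact: lem_addl.
have g0 : f - h' * b.2 != 0.
  by apply: contraNneq neq => /eqP; rewrite subr_eq0 => /eqP ->;
    rewrite rmorphN /= mleadN.
have := mleadD neq; rewrite -rmorphD /= => gl.
have [k [gk stdk]] : exists k, mlead (psi (f - h' * b.2)) = key k /\ standard B k.
  rewrite gl; case: (leP (mlead _) (mlead _)) => _; last by exists u.
  exists (v + b.1)%MM; split=> //; apply/allP => b' b'B.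
  have /allP/(_ b' b'B) := hz v hv; apply: contra; apply: coprime_mnm_le.
  exact: co.
by have := IH _ _ leadB' pw Bg g0 gk; rewrite stdk.
Qed.

Lemma standard_eq0 B f : (forall b, b \in B -> has_lead b) ->
    pairwise (fun b b' => coprime_mnm b.1 b'.1) B ->
  in_ideal B f -> std_supp B f -> f = 0.
Proof.
move=> leadB pw Bf stdf; have [//|f0] := eqVneq f 0.
have [u fu fl] := mlead_psi f0.
by have := groebner_lead leadB pw Bf f0 fl; rewrite (stdf u fu).
Qed.

(** The remainder g of f has g^k in the ideal, so some leading monomial divides k times that of g;
    being squarefree, it divides that of g itself. *)
Lemma squarefree_radical B f k : (forall b, b \in B -> has_lead b) ->
    pairwise (fun b b' => coprime_mnm b.1 b'.1) B ->
    (forall b i, b \in B -> (b.1 i <= 1)%N) ->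
  in_ideal B (f ^+ k) -> in_ideal B f.
Proof.
move=> leadB pw sqf Bfk; have [z Bz stdz] := ideal_reduction f leadB.
set g := f - z in stdz; suff g0 : g = 0.
  by rewrite -(subrK z f) -/g g0 add0r.
have [//|g0] := eqVneq g 0; have [u gu gl] := mlead_psi g0.
have Bgk : in_ideal B (g ^+ k).
  rewrite -(subrK (f ^+ k) (g ^+ k)) subrXX; apply: in_idealD => //.
  by rewrite /g addrAC subrr add0r; apply/in_idealMr/in_idealN.
have gkl : mlead (psi (g ^+ k)) = key (u *+ k)%MM.
  by rewrite rmorphXn /= mleadX ?psi_neq0 // gl -mexpMn.
have /standardPn[b bB bk] := groebner_lead leadB pw Bgk (expf_neq0 k g0) gkl.
have /allP/(_ b bB)/negP[] := stdz u gu; apply/mnm_lepP => i.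
have /mnm_lepP/(_ i) := bk; rewrite mulmnE; have := sqf b i bB.
by case: (b.1 i) => [|[]] // _; case: (u i).
Qed.

End Groebner.

(** * Binomial relations and saturation *)

Section Lattice.
Variable n : nat.

(* A quadruple ((a, b), (c, d)) stands for the rewriting rule                  *)
(* X_a X_b --> - X_c X_d.                                                     *)
Definition rule := (('I_n * 'I_n) * ('I_n * 'I_n))%type.
Implicit Types (e : rule) (s : seq rule) (x y : 'rV[int]_n).

Lemma rvD x y i : (x + y) 0 i = x 0 i + y 0 i. Proof. by rewrite mxE. Qed.
Lemma rvN x i : (- x) 0 i = - x 0 i. Proof. by rewrite mxE. Qed.
Lemma rvZ (k : int) x i : (k *: x) 0 i = k * x 0 i. Proof. by rewrite mxE. Qed.
Lemma rv0 i : (0 : 'rV[int]_n) 0 i = 0. Proof. by rewrite mxE. Qed.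

Let rvE := (rvD, rvN, rvZ, rv0).

Definition touched e : seq 'I_n := [:: e.1.1; e.1.2; e.2.1; e.2.2].

Definition rule_wf e :=
  [&& e.1.1 != e.1.2, e.1.1 \notin [:: e.2.1; e.2.2]
    & e.1.2 \notin [:: e.2.1; e.2.2]].

(** Later rules do not touch the leading pair of an earlier one, so a single pass through the list
    settles every pair. *)
Definition triangular s := all rule_wf s &&
  pairwise (fun e e' => (e.1.1 \notin touched e') && (e.1.2 \notin touched e')) s.

Definition move e : 'rV[int]_n :=
  delta_mx 0 e.1.1 + delta_mx 0 e.1.2 - delta_mx 0 e.2.1 - delta_mx 0 e.2.2.

(** Only multiples of moves are subtracted, and for triangular [s] every move is killed: the kernel
    is the lattice of moves, so the values are coordinates on the quotient. *)
Fixpoint eliminate s x : 'rV[int]_n :=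
  if s is e :: s' then eliminate s' (x - x 0 e.1.1 *: move e) else x.

Definition standard_vec s x :=
  forall e, e \in s -> Num.min (x 0 e.1.1) (x 0 e.1.2) = 0.

Lemma triangular_cons e s : triangular (e :: s) ->
  [/\ rule_wf e, triangular s &
    forall e', e' \in s -> e.1.1 \notin touched e' /\ e.1.2 \notin touched e'].
Proof.
move=> /andP[/= /andP[we ws] /andP[/allP es ps]]; split => //.
  by rewrite /triangular ws ps.
by move=> e' /es/andP.
Qed.

Lemma move_untouched e i : i \notin touched e -> move e 0 i = 0.
Proof.
rewrite !inE !negb_or => /and4P[ia ib ic id].
by rewrite !mxE /= (negPf ia) (negPf ib) (negPf ic) (negPf id).
Qed.

Lemma move_lead e : rule_wf e -> move e 0 e.1.1 = 1 /\ move e 0 e.1.2 = 1.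
Proof.
rewrite /rule_wf !inE !negb_or => /and3P[ab /andP[ac ad] /andP[bc bd]].
rewrite !mxE /= !eqxx (negPf ab) (eq_sym e.1.2) (negPf ab).
by rewrite (negPf ac) (negPf ad) (negPf bc) (negPf bd).
Qed.

Lemma move_bound e i : (`|move e 0 i| <= 2).
Proof. by rewrite !mxE /=; do 4!case: (_ == _). Qed.

Lemma eliminate_linear s : linear (eliminate s).
Proof.
elim: s => //= e s IH k x y; rewrite -IH; congr (eliminate s _).
by move: (move e) => z; rewrite !rvE scalerDl scalerBr -scalerA opprD addrACA.
Qed.

HB.instance Definition _ s := GRing.isLinear.Build int 'rV[int]_n 'rV[int]_n _
  (eliminate s) (eliminate_linear s).

Lemma eliminate_untouched s x i :
  (forall e, e \in s -> i \notin touched e) -> eliminate s x 0 i = x 0 i.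
Proof.
elim: s x => //= e s IH x si; rewrite IH => [|e' e's]; last first.
  by apply: si; rewrite inE e's orbT.
have := @move_untouched e i (si e (mem_head _ _)).
by rewrite !rvE => ->; rewrite mulr0 subr0.
Qed.

Lemma eliminate_move s e : triangular s -> e \in s -> eliminate s (move e) = 0.
Proof.
elim: s => //= e0 s IH /triangular_cons[we ts es]; rewrite inE => /predU1P[->|se].
  by rewrite (move_lead we).1 scale1r subrr raddf0.
by rewrite move_untouched ?(es _ se).1 // scale0r subr0 IH.
Qed.

(** Subtract min(x_a, x_b) times each move in turn. For nonnegative x this leaves the pair a, b
    nonnegative and can only raise the entries at c and d. *)
Lemma straighten s x : triangular s ->
  exists y, [/\ standard_vec s y, eliminate s y = eliminate s x,
    (forall i, 0 <= x 0 i) -> (forall i, 0 <= y 0 i) &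
    forall i, (forall e, e \in s -> i \notin touched e) -> y 0 i = x 0 i].
Proof.
elim: s x => [|e s IH] x; first by exists x.
move=> ts; have [we ts' es] := triangular_cons ts.
have [ma mb] := move_lead we.
set mu := Num.min (x 0 e.1.1) (x 0 e.1.2).
have [y [ys yE y_ge0 yx]] := IH (x - mu *: move e) ts'.
have x1E i : (x - mu *: move e) 0 i = x 0 i - mu * move e 0 i.
  by rewrite !rvE.
have ya : y 0 e.1.1 = x 0 e.1.1 - mu.
  by rewrite yx ?x1E ?ma ?mulr1 // => e' /es[].
have yb : y 0 e.1.2 = x 0 e.1.2 - mu.
  by rewrite yx ?x1E ?mb ?mulr1 // => e' /es[].
exists y; split.
- move=> e'; rewrite inE => /predU1P[->|/ys //].
  by rewrite ya yb /mu; lia.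
- rewrite /= linearB /= yE ya -linearB /=; congr (eliminate s _).
  by move: (move e) => z; rewrite scalerBl opprB addrA addrNK.
- move=> x0; apply: y_ge0 => i; rewrite x1E.
  have mu0 : 0 <= mu by rewrite /mu; have := x0 e.1.1; have := x0 e.1.2; lia.
  have [ie|ie] := boolP (i \in touched e);
    last by rewrite move_untouched // mulr0 subr0.
  have xi := x0 i; move: ie; rewrite !inE => /or4P[] /eqP ie; subst i.
  + by rewrite ma /mu; lia.
  + by rewrite mb /mu; lia.
  + suff : move e 0 e.2.1 <= 0 by nia.
    move: we; rewrite /rule_wf !inE !negb_or => /and3P[ab /andP[ac ad] /andP[bc bd]].
    by rewrite !mxE /= ![e.2.1 == _]eq_sym (negPf ac) (negPf bc) eqxx; case: (_ == _).
  + suff : move e 0 e.2.2 <= 0 by nia.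
    move: we; rewrite /rule_wf !inE !negb_or => /and3P[ab /andP[ac ad] /andP[bc bd]].
    by rewrite !mxE /= ![e.2.2 == _]eq_sym (negPf ad) (negPf bd) eqxx; case: (_ == _).
- move=> i ie; rewrite yx => [|e' e's]; last by apply: ie; rewrite inE e's orbT.
  by rewrite x1E move_untouched ?mulr0 ?subr0 // ie ?mem_head.
Qed.

(** With C = 0 this is uniqueness of the standard representative; the general bound is what
    saturation needs. Absorbing k times a move, with |k| <= C, into z costs a factor 3 per rule. *)
Lemma standard_vec_dist s x y z (C : int) : triangular s ->
    standard_vec s x -> standard_vec s y -> eliminate s (x - y - z) = 0 ->
    (forall i, `|z 0 i| <= C) ->
  forall i, `|x 0 i - y 0 i| <= 3 ^+ size s * C.
Proof.
elim: s z C => [|e s IH] z C.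
  move=> _ _ _ /= /rowP xyz zC i; have := zC i.
  by have := xyz i; rewrite !rvE expr0 mul1r; lia.
move=> ts sx sy; have [we ts' es] := triangular_cons ts.
have [ma mb] := move_lead we.
move=> /= xyz zC i; pose k : int := (x - y - z) 0 e.1.1.
have xb : (x - y - z) 0 e.1.2 = k.
  have := congr1 (fun v : 'rV_n => v 0 e.1.2) xyz.
  rewrite eliminate_untouched; last by move=> e' /es[].
  by rewrite (rvD (x - y - z)) (rvN (_ *: _)) rvZ mb rv0 -/k; move: k;
    rewrite !rvE; lia.
have xa : (x - y - z) 0 e.1.1 = k by [].
(* The differences x_a - y_a and x_b - y_b both lie within C of k, while min(x_a, x_b) = min(y_a,
   y_b) = 0; hence 0 lies within C of k. *)
have kC : `|k| <= C.
  have := zC e.1.1; have := zC e.1.2; have := sx e (mem_head _ _).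
  have := sy e (mem_head _ _); move: xa xb; clearbody k; rewrite !rvE; lia.
rewrite exprSr -mulrA; apply: (IH (z + k *: move e) (3 * C)) => //.
- by move=> e' e's; apply: sx; rewrite inE e's orbT.
- by move=> e' e's; apply: sy; rewrite inE e's orbT.
- by rewrite opprD addrA.
- move=> j; have := zC j; have := move_bound e j.
  by rewrite !rvE; nia.
Qed.

Definition dot (D : 'I_n -> nat) x : int := \sum_i (D i)%:Z * x 0 i.

Lemma dot_linear D : scalar (dot D).
Proof.
move=> k x y; rewrite /dot mulr_sumr -big_split; apply: eq_bigr => i _ /=.
by rewrite !mxE; ring.
Qed.

HB.instance Definition _ D := GRing.isLinear.Build int 'rV[int]_n int _
  (dot D) (dot_linear D).

Lemma dot_delta D i : dot D (delta_mx 0 i) = D i.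
Proof.
rewrite /dot (bigD1 i) //= mxE !eqxx mulr1 big1 ?addr0 // => j ji.
by rewrite mxE (negPf ji) mulr0.
Qed.

Section Key.
Variables (s : seq rule) (D : 'I_n -> nat).
Hypotheses (s_tri : triangular s) (D_gt0 : forall i, (0 < D i)%N)
  (D_bal : forall e, e \in s -> (D e.1.1 + D e.1.2 = D e.2.1 + D e.2.2)%N).

Lemma dot_eliminate x : dot D (eliminate s x) = dot D x.
Proof.
have dm e : e \in s -> dot D (move e) = 0.
  move=> /D_bal be; rewrite /move !raddfB raddfD /= !dot_delta; lia.
elim: (s) x dm => //= e s' IH x dm; rewrite IH => [|e' e's]; last first.
  by apply: dm; rewrite inE e's orbT.
by rewrite raddfB /= linearZ /= dm ?mem_head // mulr0 subr0.
Qed.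

Definition coord_size : nat :=
  (\sum_i \sum_j `|(eliminate s (delta_mx 0 i) 0 j)%R|)%N.

(** The factor 4 lets the weight [D] outweigh the coordinate sums of the four variables compared in
    [mdeg_key_lt]. *)
Definition key_offset : nat := (coord_size * 4).+1.

(* The coordinates modulo the lattice spanned by the [move e], shifted by a    *)
(* multiple of the invariant weight [D] that makes them nonnegative.          *)
Definition key_exp (i : 'I_n) : 'X_{1..n} :=
  [multinom `|(eliminate s (delta_mx 0 i) 0 j + (key_offset * D i)%:Z)%R|%N | j < n].

Definition vec (u : 'X_{1..n}) : 'rV[int]_n := \row_j (u j)%:Z.

Local Notation key := (mexp key_exp).

Lemma vecD u v : vec (u + v)%MM = vec u + vec v.
Proof. by apply/rowP => j; rewrite !mxE mnmDE PoszD. Qed.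

Lemma vecMn u k : vec (u *+ k)%MM = k%:Z *: vec u.
Proof. by apply/rowP => j; rewrite !mxE mulmnE PoszM mulrC. Qed.

Lemma vecU i : vec U_(i)%MM = delta_mx 0 i.
Proof. by apply/rowP => j; rewrite !mxE eqxx mnm1E eq_sym; case: (_ == _). Qed.

Lemma vec_sum u : vec u = \sum_i (u i)%:Z *: delta_mx 0 i.
Proof.
rewrite [LHS]row_sum_delta; apply: eq_bigr => i _; congr (_ *: _).
by rewrite mxE.
Qed.

Lemma key_expE i j :
  (key_exp i j)%:Z = eliminate s (delta_mx 0 i) 0 j + (key_offset * D i)%:Z.
Proof.
rewrite mnmE; set x := eliminate _ _ _ _.
have xle : (`|x| <= coord_size)%N.
  by rewrite /coord_size (bigD1 i) //= (bigD1 j) //= -addnA leq_addr.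
have := D_gt0 i; move: xle; rewrite /key_offset.
by move: coord_size (D i) => S d; nia.
Qed.

Lemma keyE u j :
  (key u j)%:Z = eliminate s (vec u) 0 j + key_offset%:Z * dot D (vec u).
Proof.
rewrite mexpE (big_morph Posz PoszD (erefl _)) vec_sum !raddf_sum /= summxE mulr_sumr.
rewrite -big_split /=; apply: eq_bigr => i _.
rewrite PoszM key_expE !linearZ /= dot_delta rvZ PoszM.
by ring.
Qed.

Lemma key_eqP u v : key u = key v <-> eliminate s (vec u) = eliminate s (vec v).
Proof.
split=> [/mnmP kuv|Euv]; last first.
  apply/mnmP => j; apply/eqP; rewrite -eqz_nat !keyE Euv.
  by rewrite -(dot_eliminate (vec u)) Euv dot_eliminate.
apply/eqP; rewrite -subr_eq0 -raddfB /=; set x := vec u - vec v.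
have xE j : eliminate s x 0 j + key_offset%:Z * dot D x = 0.
  by have := congr1 Posz (kuv j); rewrite !keyE /x !raddfB /= !rvE; lia.
(* Pairing [xE] with [D] and using [dot_eliminate] gives (1 + [key_offset] * sum of the D_j) t = 0
   for t = [dot D x]. *)
have x0 : dot D x = 0.
  have tE := dot_eliminate x; move: (dot D x) xE tE => t xE.
  rewrite /dot (eq_bigr (fun j => - ((D j)%:Z * (key_offset%:Z * t)))); last first.
    by move=> j _; rewrite -mulrN; congr (_ * _); have := xE j; lia.
  rewrite sumrN -mulr_suml -(big_morph Posz PoszD (erefl _)).
  by move: (\sum_i _)%N key_offset => S o; nia.
by apply/eqP/rowP => j; have := xE j; rewrite x0 mulr0 addr0 => ->; rewrite mxE.
Qed.

Definition standard_mnm (u : 'X_{1..n}) :=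
  all (fun e => (u e.1.1 == 0%N) || (u e.1.2 == 0%N)) s.

Lemma standard_vecE u : standard_mnm u -> standard_vec s (vec u).
Proof. by move=> /allP su e /su; rewrite !mxE; lia. Qed.

Lemma key_inj_standard u v :
  standard_mnm u -> standard_mnm v -> key u = key v -> u = v.
Proof.
move=> /standard_vecE su /standard_vecE sv /key_eqP uv; apply/mnmP => i.
have := @standard_vec_dist s (vec u) (vec v) 0 0 s_tri su sv.
rewrite subr0 raddfB /= uv subrr => /(_ (erefl _)) H.
have /H/(_ i) : forall j, `|(0 : 'rV[int]_n) 0 j| <= 0 by move=> j; rewrite mxE.
by rewrite !mxE mulr0; lia.
Qed.

Lemma key_balance e : e \in s ->
  key (U_(e.1.1) + U_(e.1.2))%MM = key (U_(e.2.1) + U_(e.2.2))%MM.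
Proof.
move=> se; apply/key_eqP; apply/eqP; rewrite -subr_eq0 -raddfB /= !vecD !vecU.
by rewrite opprD addrA -/(move e) (eliminate_move s_tri se).
Qed.

Lemma mdeg_key u : (mdeg (key u))%:Z =
  (\sum_j eliminate s (vec u) 0 j) + (n * key_offset)%:Z * dot D (vec u).
Proof.
rewrite mdegE (big_morph Posz PoszD (erefl _)).
under eq_bigr do rewrite keyE.
rewrite big_split /= sumr_const card_ord PoszM -mulrA; congr (_ + _).
by rewrite -mulr_natl natz.
Qed.

Lemma mdeg_key_lt p q a b : (D p + D q < D a + D b)%N ->
  (mdeg (key (U_(p) + U_(q))%MM) < mdeg (key (U_(a) + U_(b))%MM))%N.
Proof.
move=> lt; rewrite -ltz_nat !mdeg_key !vecD !vecU !raddfD /= !dot_delta.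
have le i : `|\sum_j eliminate s (delta_mx 0 i) 0 j|
    <= coord_size%:Z.
  apply: (le_trans (Num.Theory.ler_norm_sum _ _ _)).
  apply: (@le_trans _ _ (\sum_j `|(eliminate s (delta_mx 0 i) 0 j)%R|)%N%:Z).
    by rewrite (big_morph Posz PoszD (erefl _)).
  by rewrite lez_nat [leqRHS](bigD1 i) //= leq_addr.
have sumE i j : \sum_l (eliminate s (delta_mx 0 i) + eliminate s (delta_mx 0 j)) 0 l =
    \sum_l eliminate s (delta_mx 0 i) 0 l + \sum_l eliminate s (delta_mx 0 j) 0 l.
  by rewrite -big_split; apply: eq_bigr => l _; rewrite mxE.
rewrite !sumE; have n0 : (0 < n)%N by apply: leq_ltn_trans (ltn_ord p).
have := le p; have := le q; have := le a; have := le b; rewrite /key_offset.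
move: coord_size (\sum_l _) (\sum_l _) (\sum_l _) (\sum_l _) => S x y z t.
move: lt; move: (D p) (D q) (D a) (D b) => d1 d2 d3 d4 lt X Y Z T.
have : ((n * (S * 4).+1)%:Z * (d1%:Z + d2%:Z + 1) <= (n * (S * 4).+1)%:Z * (d3%:Z + d4%:Z)).
  by apply: Num.Theory.ler_wpM2l => //; lia.
have : ((S * 4).+1 <= n * (S * 4).+1)%N by apply: leq_pmull.
by move: (n * _)%N => P; lia.
Qed.

(** Let g be the standard representative of u - v. All its multiples k g are standard, and k g
    differs by a bound independent of k from the nonnegative standard representative of r. Hence g
    >= 0, and g is the required exponent. *)
Lemma key_saturated u v t :
    (forall k, exists r, key (t + u *+ k)%MM = key (v *+ k + r)%MM) ->
  exists r, key u = key (v + r)%MM.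
Proof.
move=> H; have [g [gs gE _ _]] := straighten (vec u - vec v) s_tri.
pose C : int := (\sum_i t i)%N%:Z.
have tC i : `|vec t 0 i| <= C.
  by rewrite mxE /C (bigD1 i) //=; lia.
have bound k i : - (3 ^+ size s * C) <= k%:Z * g 0 i.
  have [r /(key_eqP _ _) ] := H k; rewrite !vecD !vecMn => rE.
  have [y [ys yE y_ge0 _]] := straighten (vec r) s_tri.
  have {}y_ge0 : 0 <= y 0 i by apply: y_ge0 => j; rewrite mxE.
  have kgs : standard_vec s (k%:Z *: g).
    move=> e /gs; rewrite !rvZ; move: (g 0 e.1.1) (g 0 e.1.2) => p q pq.
    have [[-> q0]|[-> p0]] : (p = 0 /\ 0 <= q) \/ (q = 0 /\ 0 <= p) by lia.
      by rewrite mulr0 min_l // Num.Theory.mulr_ge0.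
    by rewrite mulr0 min_r // Num.Theory.mulr_ge0.
  have := @standard_vec_dist s y (k%:Z *: g) (vec t) C s_tri ys kgs.
  have -> : eliminate s (y - k%:Z *: g - vec t) = 0.
    move: rE; rewrite !linearD !linearN !linearZ /= yE gE (linearB (eliminate s)) /= => rE.
    have -> : eliminate s (vec r) = eliminate s (vec t) +
        k%:Z *: eliminate s (vec u) - k%:Z *: eliminate s (vec v).
      by rewrite rE addrAC subrr add0r.
    by rewrite opprB scalerBr addrA addrNK addrK subrr.
  move=> /(_ (erefl _) tC i); rewrite !rvE.
  by move: y_ge0; move: (y 0 i) (k%:Z * g 0 i) (3 ^+ size s * C) => o p q; lia.
have g_ge0 i : 0 <= g 0 i.
  have := bound (absz (3 ^+ size s * C)).+1 i;
    move: (3 ^+ size s * C) (g 0 i) => B x; nia.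
pose r : 'X_{1..n} := [multinom `|(g 0 i)%R|%N | i < n].
exists r; apply/key_eqP; rewrite vecD raddfD /=.
have -> : vec r = g by apply/rowP => i; rewrite mxE mnmE; have := g_ge0 i; lia.
by rewrite gE raddfB /= addrC subrK.
Qed.

End Key.

End Lattice.

(** * Toric degenerations *)

Section ToricDegeneration.
Variables (n : nat) (K : fieldType) (T : eqType) (es : seq T) (ru : T -> rule n).
Variables (w D : 'I_n -> nat).
Variables (c : 'I_n -> K) (g : T -> {mpoly K[n]}).
Variable rest : T -> seq ('I_n * 'I_n).
Local Notation s := (map ru es).
Hypotheses (s_tri : triangular s) (w_gt0 : forall i, (0 < w i)%N)
  (D_gt0 : forall i, (0 < D i)%N) (c_neq0 : forall i, c i != 0).
Hypothesis D_bal : forall e, e \in es ->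
  (D (ru e).1.1 + D (ru e).1.2 = D (ru e).2.1 + D (ru e).2.2)%N.
Hypothesis w_tail : forall e, e \in es ->
  (w (ru e).2.1 + w (ru e).2.2 < w (ru e).1.1 + w (ru e).1.2)%N.
Hypothesis c_bal : forall e, e \in es ->
  c (ru e).1.1 * c (ru e).1.2 = - (c (ru e).2.1 * c (ru e).2.2).
Hypothesis gE : forall e, e \in es -> g e = 'X_((ru e).1.1) * 'X_((ru e).1.2) +
  ('X_((ru e).2.1) * 'X_((ru e).2.2) + \sum_(p <- rest e) 'X_(p.1) * 'X_(p.2)).
Hypothesis rest_lt : forall e p, e \in es -> p \in rest e ->
  (w p.1 + w p.2 < w (ru e).1.1 + w (ru e).1.2)%N /\ (D p.1 + D p.2 < D (ru e).1.1 + D (ru e).1.2)%N.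

Local Notation lead e := (U_((ru e).1.1) + U_((ru e).1.2))%MM.
Local Notation tail e := (U_((ru e).2.1) + U_((ru e).2.2))%MM.
Local Notation pair p := (U_(p.1) + U_(p.2))%MM.

Definition gens := [seq (lead e, g e) | e <- es].

Local Notation I := (in_ideal gens).
Local Notation key := (mexp (key_exp s D)).
Local Notation phi := (msubst c (key_exp s D)).

Let s_bal r : r \in s -> (D r.1.1 + D r.1.2 = D r.2.1 + D r.2.2)%N.
Proof. by move=> /mapP[e ee ->]; exact: D_bal. Qed.

Let gens_lead : forall b, b \in gens -> has_lead w b.
Proof.
move=> _ /mapP[e ee ->]; apply: (has_lead_pairs (p0 := (ru e).1) (r := (ru e).2 :: rest e)).
  by rewrite big_cons gE.
by move=> p; rewrite inE => /predU1P[->|/(rest_lt ee)[]//]; exact: w_tail.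
Qed.

Let gens_coprime : pairwise (fun b b' => coprime_mnm b.1 b'.1) gens.
Proof.
rewrite pairwise_map; have /andP[_] := s_tri; rewrite pairwise_map;
  apply: sub_pairwise => e e' /=.
rewrite /touched !inE !negb_or => /andP[/and4P[aa ab _ _] /and4P[ba bb _ _]].
apply/forallP => i; rewrite /= !mnmDE !mnm1E !addn_eq0 !eqb0.
have [<-|] := eqVneq (ru e).1.1 i; first by rewrite ![_ == (ru e).1.1]eq_sym aa ab orbT.
have [<-|] := eqVneq (ru e).1.2 i; last by [].
by rewrite ![_ == (ru e).1.2]eq_sym ba bb orbT.
Qed.

Let lead_le e u : e \in es ->
  (lead e <= u)%MM = (u (ru e).1.1 != 0%N) && (u (ru e).1.2 != 0%N).
Proof.
move=> ee; have /andP[/allP/(_ _ (map_f ru ee))/and3P[ab _ _] _] := s_tri.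
apply/mnm_lepP/andP => [le|[ua ub] i].
  have := le (ru e).1.1; have := le (ru e).1.2; rewrite !mnmDE !mnm1E !eqxx (negPf ab).
  by rewrite eq_sym (negPf ab); split; lia.
rewrite mnmDE !mnm1E; have [<-|_] := eqVneq (ru e).1.1 i.
  by rewrite eq_sym (negPf ab); lia.
by have [<-|//] := eqVneq (ru e).1.2 i; lia.
Qed.

Let standardE u : standard gens u = standard_mnm s u.
Proof.
rewrite /standard /standard_mnm !all_map; apply: eq_in_all => e ee /=.
by rewrite lead_le // negb_and !negbK.
Qed.

Let key_inj h : std_supp gens h -> {in msupp h &, injective key}.
Proof.
move=> sh u v /sh su /sh sv; apply: (key_inj_standard s_tri D_gt0 s_bal);
  by rewrite -standardE.
Qed.

Let std_eq0 h : I h -> std_supp gens h -> h = 0.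
Proof. exact: (@standard_eq0 n K w w_gt0 gens h gens_lead gens_coprime). Qed.

Let key_lead e : e \in es -> key (lead e) = key (tail e).
Proof. by move=> ee; apply: key_balance s_tri D_gt0 s_bal _ (map_f ru ee). Qed.

(** The two terms of the binomial have equal keys and opposite scalars, so they cancel; the rest has
    smaller weight [D]. *)
Let phi_gen e m : e \in es -> m \in msupp (phi (g e)) ->
  (mdeg m < mdeg (key (lead e)))%N.
Proof.
move=> ee; rewrite gE // !rmorphD rmorph_sum /= addrA -!mpolyXD !msubstX.
rewrite -key_lead // !mscalD !mscalU c_bal // -scalerDl addNr scale0r add0r.
move=> /msupp_sum_le/flatten_mapP[p]; rewrite filter_predT => pe.
rewrite -mpolyXD msubstX => /msuppZ_le/mem_msuppXP <-.
by have [_] := rest_lt ee pe; apply: mdeg_key_lt.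
Qed.

Let std_phi h : std_supp gens h -> h != 0 ->
  [/\ phi h != 0, exists2 u, u \in msupp h & mlead (phi h) = key u &
    forall u, u \in msupp h -> (mdeg (key u) <= mdeg (mlead (phi h)))%N].
Proof.
move=> sh h0; have inj := key_inj sh; split; first exact: msubst_neq0.
- exact: mlead_msubst.
- by move=> u hu; apply/lemc_mdeg/msupp_le_mlead/mexp_msupp.
Qed.

(** Each rewriting step keeps key degrees at most d and subtracts a multiple of a generator whose
    image has degree below d. So [phi f] and [phi h] agree in degree d. *)
Lemma normal_form d f : (forall u, u \in msupp f -> (mdeg (key u) <= d)%N) ->
  exists h, [/\ std_supp gens h, I (f - h) &
    forall m, m \in msupp (phi (f - h)) -> (mdeg m < d)%N].
Proof.
move=> fd; pose Z z := I z /\ forall m, m \in msupp (phi z) -> (mdeg m < d)%N.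
have [|||u ud /standardPn[_ /mapP[e ee ->] /= eu]||z [Iz zd] zP] := @reduction n K (wdeg w)
  (fun u => ~~ standard gens u) (fun u => mdeg (key u) <= d)%N Z _ _ _ _ f => //.
- by split; [exact: in_ideal0|rewrite raddf0 msupp0].
- move=> f1 f2 [If1 f1d] [If2 f2d]; split; first exact: in_idealD.
  by move=> m; rewrite rmorphD => /msuppD_le; rewrite mem_cat => /orP[/f1d|/f2d].
- move=> a f1 [If1 f1d]; split; first exact: in_idealZ.
  by move=> m; rewrite msubstZ => /msuppZ_le/f1d.
- have uE : u = (u - lead e + lead e)%MM by rewrite submK.
  have kuE : mdeg (key u) = (mdeg (key (u - lead e)%MM) + mdeg (key (lead e)))%N.
    by rewrite {1}uE mexpD mdegD.
  exists ('X_[u - lead e] * g e).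
    split; first by apply/in_idealMl/(in_ideal_mem (b := (lead e, g e)))/map_f.
    move=> m; rewrite rmorphM /= => /msuppM_le/allpairsP[[x y] /= []].
    rewrite msubstX => /msuppZ_le/mem_msuppXP <- /(phi_gen ee) ylt ->.
    by rewrite mdegD; apply: leq_trans ud; rewrite kuE ltn_add2l.
  move=> v; rewrite gE // mulrDr -!mpolyXD -uE opprD addNKr (perm_mem (msuppN _)).
  move=> /msuppM_le/allpairsP[[x y] /= [/mem_msuppXP <- yP ->]].
  suff [yk yw] : (mdeg (key y) <= mdeg (key (lead e)))%N /\
      (wdeg w y < wdeg w (lead e))%N.
    split; first by rewrite mexpD mdegD; apply: leq_trans ud; rewrite kuE leq_add2l.
    by rewrite {2}uE !(wdegD w (u - _)) ltn_add2l.
  move/msuppD_le: yP; rewrite mem_cat => /orP[/mem_msuppXP <-|].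
    by rewrite key_lead // !wdegD !wdegU w_tail.
  move=> /msupp_sum_le/flatten_mapP[p]; rewrite filter_predT => pe.
  rewrite -mpolyXD => /mem_msuppXP <-; rewrite !wdegD !wdegU.
  by have [-> pD] := rest_lt ee pe; split=> //; apply/ltnW/mdeg_key_lt.
exists (f - z); rewrite subKr; split => //.
by move=> u /zP[_]; rewrite negbK.
Qed.

Lemma normal_form_lead f : phi f != 0 ->
    (forall u, u \in msupp f -> (mdeg (key u) <= mdeg (mlead (phi f)))%N) ->
  exists h, [/\ std_supp gens h, h != 0, I (f - h),
    mlead (phi h) = mlead (phi f) & mleadc (phi h) = mleadc (phi f)].
Proof.
move=> f0 fd; have [h [sh Ifh hd]] := normal_form fd.
have phE : phi h = phi f - phi (f - h) by rewrite rmorphB subKr.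
have low : (phi (f - h))@_(mlead (phi f)) = 0.
  by apply/eqP; rewrite mcoeff_eq0; apply/negP => /hd; rewrite ltnn.
have lE : mlead (phi h) = mlead (phi f).
  rewrite phE; have [->|r0] := eqVneq (phi (f - h)) 0; first by rewrite subr0.
  by rewrite mleadDl // mleadN; apply/lt_mdeg_ltmc/hd/mlead_supp.
have cE : mleadc (phi h) = mleadc (phi f).
  by rewrite lE phE mcoeffB low subr0.
exists h; split => //; apply: contraNneq f0 => h0.
by rewrite -mleadc_eq0 -cE h0 raddf0 mcoeff0.
Qed.

(* The valuation of the class of [f] modulo [I] is [t].                       *)
Definition has_val f t := exists h,
  [/\ std_supp gens h, h != 0, I (f - h) & mlead (phi h) = t].

Lemma has_val_congr f f' t : I (f - f') -> has_val f t -> has_val f' t.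
Proof.
move=> ff' [h [sh h0 fh <-]]; exists h; split => //.
by rewrite -(subrK f f') -addrA; apply: in_idealD => //; rewrite -opprB;
  exact: in_idealN.
Qed.

Lemma has_val_uniq f t t' : has_val f t -> has_val f t' -> t = t'.
Proof.
move=> [h [sh _ fh <-]] [h' [sh' _ fh' <-]]; congr (mlead (phi _)).
apply/eqP; rewrite -subr_eq0; apply/eqP/std_eq0.
  have -> : h - h' = (f - h') - (f - h) by ring.
  exact: in_idealB.
by rewrite -[h']scale1r; exact: std_suppB.
Qed.

Lemma has_valP f : ~ I f <-> exists t, has_val f t.
Proof.
split=> [If|[t [h [sh h0 fh _]]] If]; last first.
  move/eqP: h0; apply; apply: std_eq0 => //.
  by rewrite -[h](subKr f); exact: in_idealB.
have [z Iz sz] := ideal_reduction f gens_lead.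
exists (mlead (phi (f - z))), (f - z); split => //; last by rewrite subKr.
by apply: contra_notN If; rewrite subr_eq0 => /eqP ->.
Qed.

Lemma has_valM f f' t t' :
  has_val f t -> has_val f' t' -> has_val (f * f') (t + t')%MM.
Proof.
move=> [h [sh h0 fh <-]] [h' [sh' h'0 fh' <-]].
have [p0 _ pd] := std_phi sh h0; have [p'0 _ p'd] := std_phi sh' h'0.
have lE : mlead (phi (h * h')) = (mlead (phi h) + mlead (phi h'))%MM.
  by rewrite rmorphM mleadM.
have [||k [sk k0 hk kl _]] := normal_form_lead (f := h * h').
- by rewrite rmorphM mulf_neq0.
- move=> u /msuppM_le/allpairsP[[x y] /= [/pd xd /p'd yd ->]].
  by rewrite lE mexpD !mdegD leq_add.
exists k; split => //; last by rewrite kl.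
have -> : f * f' - k = (f - h) * f' + h * (f' - h') + (h * h' - k) by ring.
apply: in_idealD => //; apply: in_idealD; first exact: in_idealMr.
exact: in_idealMl.
Qed.

Lemma has_valX u : has_val 'X_[u] (key u).
Proof.
have pE : phi 'X_[u] = mscal c u *: 'X_[key u] by rewrite msubstX.
have sc0 := mscal_neq0 c_neq0 u.
have lE : mlead (phi 'X_[u]) = key u by rewrite pE mleadZ // mleadXm.
have [||h [sh h0 uh hl _]] := normal_form_lead (f := 'X_[u]).
- by rewrite pE mscalerI negb_or sc0 -msupp_eq0 msuppX.
- by move=> v /mem_msuppXP <-; rewrite lE.
by exists h; rewrite hl lE.
Qed.

Lemma has_val_exp f t k : has_val f t -> has_val (f ^+ k) (t *+ k)%MM.
Proof.
move=> ft; elim: k => [|k IH]; last by rewrite exprS mulmS; exact: has_valM.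
have := has_valX 0; rewrite mpolyX0 expr0 mulm0n.
by have -> : key 0%MM = 0%MM by apply/mnmP => j;
  rewrite mexpE mnm0E big1 // => i _; rewrite mnm0E muln0.
Qed.

Lemma has_val_key f t : has_val f t -> exists u, t = key u.
Proof. by move=> [h [sh h0 _ <-]]; have [_ [u _ ->]] := std_phi sh h0; exists u. Qed.

Lemma toric_prime f f' : I (f * f') -> I f \/ I f'.
Proof.
move=> Iff'; apply: contrapT => /not_orP[/has_valP[t ft] /has_valP[t' ft']].
by have /has_valP := ex_intro _ _ (has_valM ft ft').
Qed.

(** The hypothesis of the division argument survives a division step: expand (a - b d)^k and apply
    it to each power of a. *)
Lemma almost_integral_sub a b x d :
    (forall k, exists y, I (x * a ^+ k - b ^+ k * y)) ->
  forall k, exists y, I (x * (a - b * d) ^+ k - b ^+ k * y).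
Proof.
move=> H k; rewrite exprDn mulr_sumr.
elim/big_ind: _ => [|p q [y py] [z qz]|i _].
- by exists 0; rewrite mulr0 subr0; exact: in_ideal0.
- by exists (y + z); rewrite mulrDr opprD addrACA; exact: in_idealD.
have [y xy] := H (k - i)%N.
exists (y * ((- d) ^+ i * 'C(k, i)%:R)).
have -> : b ^+ k = b ^+ (k - i) * b ^+ i by rewrite -exprD subnK // -ltnS.
rewrite -mulrN exprMn -mulr_natr.
rewrite (_ : _ - _ = (x * a ^+ (k - i) - b ^+ (k - i) * y) *
  (b ^+ i * ((- d) ^+ i * 'C(k, i)%:R))); first exact: in_idealMr.
by move: (_ ^+ _) (_ ^+ _) (_ ^+ _) (_ ^+ _) => p q t z; ring.
Qed.

(* Division in the graded ring is division of monomials, by saturation; it    *)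
(* lowers the valuation of the dividend, and the monomial order is well       *)
(* founded.                                                                   *)
Lemma toric_almost_integral a b x : ~ I b -> ~ I x ->
    (forall k, exists y, I (x * a ^+ k - b ^+ k * y)) ->
  exists d, I (a - b * d).
Proof.
move=> Ib Ix; have [Ia _|/has_valP[ta]] := pselect (I a).
  by exists 0; rewrite mulr0 subr0.
have /has_valP[tb vb] := Ib; have /has_valP[tx vx] := Ix.
elim/(@ltmwf n): ta a => ta IH a va H.
have [ua taE] := has_val_key va; have [ub tbE] := has_val_key vb.
have [ux txE] := has_val_key vx.
(* Comparing valuations in x a^k = b^k y gives the hypothesis of saturation, with the value of x as
   the bounded error. *)
have [k|r] := @key_saturated n s D s_tri D_gt0 s_bal ua ub ux.
  have [y xy] := H k; have vxa := has_val_congr xy (has_valM vx (has_val_exp k va)).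
  have [|t vy] := (has_valP y).1.
    by move=> Iy; case: ((has_valP (b ^+ k * y)).2 (ex_intro _ _ vxa));
      exact: in_idealMl.
  have [r tE] := has_val_key vy; exists r.
  have := has_val_uniq vxa (has_valM (has_val_exp k vb) vy).
  by rewrite tE txE taE tbE !mexpD !mexpMn.
rewrite mexpD -taE -tbE => trE.
have [a' [sa a0 aa al]] := va; have [b' [sb b0 bb bl]] := vb.
have [pb0 _ pbd] := std_phi sb b0.
have pXE : phi 'X_[r] = mscal c r *: 'X_[key r] by rewrite msubstX.
have sc0 := mscal_neq0 c_neq0 r.
have pX0 : phi 'X_[r] != 0 by rewrite pXE mscalerI negb_or sc0 -msupp_eq0 msuppX.
have pl : mlead (phi (b' * 'X_[r])) = ta.
  by rewrite rmorphM /= mleadM // pXE mleadZ // mleadXm bl.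
have [||h [sh h0 ph hl hc]] := normal_form_lead (f := b' * 'X_[r]).
- by rewrite rmorphM mulf_neq0.
- move=> u /msuppM_le/allpairsP[[y z] /= [/pbd yd /mem_msuppXP <- ->]].
  by rewrite pl trE mexpD !mdegD leq_add2r -bl.
rewrite pl in hl; have [ph0 _ _] := std_phi sh h0.
(* This quotient cancels the leading term of [phi a'], so the valuation drops. *)
pose q := mleadc (phi a') / mleadc (phi h).
have d1 : I (a - b * (q *: 'X_[r]) - (a' - q *: h)).
  have -> : a - b * (q *: 'X_[r]) - (a' - q *: h) =
      (a - a') - (b - b') * (q *: 'X_[r]) - q *: (b' * 'X_[r] - h).
    by rewrite scalerBr scalerAr; move: (q *: 'X_[r]) (q *: h) => y z; ring.
  apply: in_idealB; last exact: in_idealZ.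
  by apply: in_idealB => //; exact: in_idealMr.
have [e0|e0] := eqVneq (a' - q *: h) 0.
  by exists (q *: 'X_[r]); rewrite e0 subr0 in d1.
have se := std_suppB (a := q) sa sh.
have v1 : has_val (a - b * (q *: 'X_[r])) (mlead (phi (a' - q *: h))).
  by exists (a' - q *: h).
have lt : (mlead (phi (a' - q *: h)) < ta)%O.
  have [pe0 _ _] := std_phi se e0.
  have pE : phi (a' - q *: h) = phi a' - q *: phi h by rewrite rmorphB /= msubstZ.
  rewrite lt_neqAle; apply/andP; split.
    apply: contraNneq pe0 => e; rewrite -mleadc_eq0 e pE mcoeffB mcoeffZ.
    by rewrite -{1}al -hl /q divfK ?subrr // mleadc_eq0.
  rewrite pE; apply: le_trans (mleadB_le _ _) _.
  by rewrite al leUx lexx /= -hl; exact: mleadZ_le.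
have [d Id] := IH _ lt _ v1 (almost_integral_sub _ H).
by exists (q *: 'X_[r] + d); rewrite mulrDr opprD addrA.
Qed.

End ToricDegeneration.

(** * The equations of isotropic frames *)

Section IsotropicFrames.
Variables (N m' : nat) (K : fieldType).
Local Notation m := m'.+1.
Local Notation V := (N * (m + m))%N.

Implicit Types e : ('I_N * 'I_N)%type.

Definition yv (i : 'I_N) (k : 'I_m) : 'I_V := mxvec_index i (lshift m k).
Definition zv (i : 'I_N) (k : 'I_m) : 'I_V := mxvec_index i (rshift m k).

Lemma mxvec_index_eq (i j : 'I_N) (k l : 'I_(m + m)) :
  (mxvec_index i k == mxvec_index j l) = (i == j) && (k == l).
Proof. by rewrite (inj_eq (@cast_ord_inj _ _ _)) (inj_eq enum_rank_inj). Qed.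

Lemma yv_eq i j k l : (yv i k == yv j l) = (i == j) && (k == l).
Proof. by rewrite mxvec_index_eq eq_lshift. Qed.

Lemma zv_eq i j k l : (zv i k == zv j l) = (i == j) && (k == l).
Proof. by rewrite mxvec_index_eq eq_rshift. Qed.

Lemma yv_zv i j k l : (yv i k == zv j l) = false.
Proof. by rewrite mxvec_index_eq eq_lrshift andbF. Qed.

Lemma zv_yv i j k l : (zv i k == yv j l) = false.
Proof. by rewrite eq_sym yv_zv. Qed.

Definition by_block T (fy fz : nat -> nat -> T) (v : 'I_V) : T :=
  mxvec (row_mx (\matrix_(i < N, k < m) fy i k) (\matrix_(i < N, k < m) fz i k)) 0 v.

Lemma by_block_y T fy fz i k : @by_block T fy fz (yv i k) = fy i k.
Proof. by rewrite /by_block mxvecE row_mxEl mxE. Qed.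

Lemma by_block_z T fy fz i k : @by_block T fy fz (zv i k) = fz i k.
Proof. by rewrite /by_block mxvecE row_mxEr mxE. Qed.

Lemma block_ind (P : 'I_V -> Prop) :
  (forall i k, P (yv i k)) -> (forall i k, P (zv i k)) -> forall v, P v.
Proof.
move=> Py Pz v; case/mxvec_indexP: v => i k.
by case: (split_ordP k) => l ->; [exact: Py|exact: Pz].
Qed.

(* Half of the diagonal entries, and the off-diagonal entries, of X Q X^T.     *)
Definition frame_gen (e : 'I_N * 'I_N) : {mpoly K[V]} :=
  \sum_k 'X_(yv e.1 k) * 'X_(zv e.2 k) +
  (if e.1 == e.2 then 0 else \sum_k 'X_(yv e.2 k) * 'X_(zv e.1 k)).

(* On y_ik z_jk the weight [w] takes the value 3m^2 + 1 + 2(j-i)k - k^2,       *)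
(* largest for k = j - i only, and [D] takes the value                        *)
(* 3m^2 + 1 + (2(j-i) + 1)k - k^2, largest for k = j - i and k = j - i + 1.   *)
Definition wy (i k : nat) := (2 * (m - i) * k + 1)%N.
Definition wz (i k : nat) := (2 * i * k + (m - k) * (3 * m + k))%N.
Definition Dz (i k : nat) := (wz i k + k)%N.

Local Notation w := (by_block wy wz).
Local Notation D := (by_block wy Dz).

Lemma weight_gt0 v : (0 < w v)%N.
Proof.
elim/block_ind: v => i k; rewrite ?by_block_y ?by_block_z /wy /wz.
  by rewrite addn1.
by have := ltn_ord k; move: (nat_of_ord k) => l lm; nia.
Qed.

Lemma weightD_gt0 v : (0 < D v)%N.
Proof.
elim/block_ind: v => i k; rewrite ?by_block_y ?by_block_z /wy /Dz /wz.
  by rewrite addn1.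
by have := ltn_ord k; move: (nat_of_ord k) => l lm; nia.
Qed.

(** The terms in m keep the weights natural and positive; in the sum over a pair they contribute a
    constant. *)
Lemma weight_sum (i j k : nat) : (i <= m)%N -> (k <= m)%N ->
  (wy i k + wz j k + k * k + 2 * i * k = 3 * m * m + 1 + 2 * j * k)%N.
Proof.
rewrite /wy /wz => /subnKC im /subnKC km.
by move: (m - i)%N (m - k)%N im km => p q im km; nia.
Qed.

Lemma weight_straight (i d k : nat) : (i <= m)%N -> (k <= m)%N ->
  (wy i k + wz (i + d) k + k * k = 3 * m * m + 1 + 2 * d * k)%N.
Proof.
move=> im km; have := weight_sum (i + d) im km.
by rewrite mulnDr mulnDl [(2 * i * k + _)%N]addnC addnA => /addIn.
Qed.

Lemma weight_cross (i d k : nat) : (i + d <= m)%N -> (k <= m)%N ->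
  (wy (i + d) k + wz i k + k * k + 2 * d * k = 3 * m * m + 1)%N.
Proof.
move=> im km; have := weight_sum i im km.
by rewrite mulnDr mulnDl [(2 * i * k + _)%N]addnC !addnA => /addIn.
Qed.

(** The argument of [inord] is in range when N <= m, and its successor in [tail_idx] when N < m:
    this is where the two bounds enter. *)
Definition lead_idx (e : 'I_N * 'I_N) : 'I_m := inord (e.2 - e.1).
Definition tail_idx (e : 'I_N * 'I_N) : 'I_m := inord (e.2 - e.1).+1.

Definition rule_of (e : 'I_N * 'I_N) : rule V :=
  ((yv e.1 (lead_idx e), zv e.2 (lead_idx e)),
   (yv e.1 (tail_idx e), zv e.2 (tail_idx e))).

(** Sorting by j - i makes the rules triangular: a lead at index d cannot meet a tail at index d' +
    1 with d' >= d. *)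
Definition upper : seq ('I_N * 'I_N) :=
  sort (fun e e' : 'I_N * 'I_N => (e.2 - e.1 <= e'.2 - e'.1)%N)
    [seq e : 'I_N * 'I_N <- enum {: 'I_N * 'I_N} | (e.1 <= e.2)%N].

Lemma mem_upper e : (e \in upper) = (e.1 <= e.2)%N.
Proof. by rewrite mem_sort mem_filter mem_enum andbT. Qed.

Lemma upper_pairwise :
  pairwise (fun e e' : 'I_N * 'I_N => (e.2 - e.1 <= e'.2 - e'.1)%N && (e != e')) upper.
Proof.
rewrite pairwise_relI; apply/andP; split; last first.
  by rewrite -uniq_pairwise sort_uniq filter_uniq // enum_uniq.
rewrite -sorted_pairwise; first by apply: sort_sorted => e e'; exact: leq_total.
by move=> e e' e''; exact: leq_trans.
Qed.

Definition frame_gens := gens upper rule_of frame_gen.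

Definition cross (e : 'I_N * 'I_N) :=
  if e.1 == e.2 then [::] else [seq (yv e.2 k, zv e.1 k) | k <- enum 'I_m].

Lemma cross_sum e : \sum_(p <- cross e) 'X_(p.1) * 'X_(p.2) =
  (if e.1 == e.2 then 0 else \sum_k 'X_(yv e.2 k) * 'X_(zv e.1 k)) :> {mpoly K[V]}.
Proof. by rewrite /cross; case: ifP => _; rewrite ?big_nil // big_map big_enum. Qed.

(** * The frame ideal is radical for N <= m *)

Section SmallRank.
Hypothesis Nm : (N <= m)%N.

Lemma lead_idxE e : e \in upper -> lead_idx e = (e.2 - e.1)%N :> nat.
Proof. by move=> _; rewrite inordK //; have := ltn_ord e.2; lia. Qed.

(** With d = j - i > 0 and up to a common constant, the lead has weights d^2 and d^2 + d, while a
    cross term has -k^2 - 2dk and k - k^2 - 2dk, both at most 0. *)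
Lemma cross_lt e p : e \in upper -> p \in cross e ->
  (w p.1 + w p.2 < w (rule_of e).1.1 + w (rule_of e).1.2)%N /\
  (D p.1 + D p.2 < D (rule_of e).1.1 + D (rule_of e).1.2)%N.
Proof.
move=> eu; have le := eu; rewrite mem_upper in le.
rewrite /cross; case: eqVneq => // ne /mapP[k _ ->].
rewrite /rule_of !by_block_y !by_block_z lead_idxE // /Dz.
have lt : (e.1 < e.2)%N by rewrite ltn_neqAle le andbT.
have := ltn_ord k; have := ltn_ord e.2.
move: (nat_of_ord e.1) (nat_of_ord e.2) (nat_of_ord k) lt => i j l ij jN lm.
have jE : j = (i + (j - i))%N by lia.
have : (0 < j - i)%N by rewrite subn_gt0.
move: (j - i)%N jE => d jE d0; subst j.
have := @weight_cross i d l ltac:(lia) ltac:(lia).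
have := @weight_straight i d d ltac:(lia) ltac:(lia).
have dd : (0 < d * d)%N by rewrite muln_gt0 d0.
have ll : (l <= l * l)%N by case: (l) => // l'; rewrite leq_pmulr.
move: (wy _ _) (wy _ _) (wz _ _) (wz _ _) => x y x' y'; rewrite -!mulnA.
move: (m * m)%N => M.
by move: (d * d)%N (l * l)%N (d * l)%N dd ll => s t r; lia.
Qed.

Lemma frame_gen_lead e : frame_gen e =
  'X_((rule_of e).1.1) * 'X_((rule_of e).1.2) + \sum_(p <-
    [seq (yv e.1 k, zv e.2 k) | k <- enum 'I_m & k != lead_idx e] ++ cross e)
    'X_(p.1) * 'X_(p.2).
Proof.
by rewrite /frame_gen (bigD1 (lead_idx e)) //= -addrA -cross_sum big_cat /= big_map big_filter big_enum_cond.
Qed.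

(** The weight deficit is (k - d)^2 with d = j - i. *)
Lemma straight_lt e k : e \in upper -> k != lead_idx e ->
  (w (yv e.1 k) + w (zv e.2 k) < w (rule_of e).1.1 + w (rule_of e).1.2)%N.
Proof.
move=> eu; have le := eu; rewrite mem_upper in le.
rewrite /rule_of !by_block_y !by_block_z -val_eqE /= lead_idxE //.
have := ltn_ord k; have := ltn_ord e.2.
move: (nat_of_ord e.1) (nat_of_ord e.2) (nat_of_ord k) le => i j l ij jN lm.
have jE : j = (i + (j - i))%N by lia.
move: (j - i)%N jE => d jE; subst j => ld.
have := @weight_straight i d l ltac:(lia) ltac:(lia).
have := @weight_straight i d d ltac:(lia) ltac:(lia).
have : (2 * (d * l) < d * d + l * l)%N.
  have [le eqd] := nat_Cauchy d l; rewrite -!mulnn in le eqd.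
  by rewrite ltn_neqAle eqd le andbT eq_sym.
move: (wy _ _) (wy _ _) (wz _ _) (wz _ _) => x y x' y'; rewrite -!mulnA.
move: (m * m)%N => M.
by move: (d * d)%N (l * l)%N (d * l)%N => s t r; lia.
Qed.

Lemma frame_has_lead b : b \in frame_gens -> has_lead w b.
Proof.
move=> /mapP[e eu ->]; apply: has_lead_pairs (frame_gen_lead e) _ => p.
rewrite mem_cat => /orP[/mapP[k]|/(cross_lt eu)[] //].
by rewrite mem_filter => /andP[ke _] -> /=; exact: straight_lt.
Qed.

Lemma lead_idx_inj e e' : e \in upper -> e' \in upper ->
  lead_idx e = lead_idx e' -> (e.1 == e'.1) || (e.2 == e'.2) -> e = e'.
Proof.
move=> eu e'u; have := eu; have := e'u; rewrite !mem_upper => le le'.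
move=> /(congr1 (@nat_of_ord _)); rewrite !lead_idxE //.
case: e e' le le' {eu e'u} => [i j] [i' j'] /= ij' ij ed.
by rewrite -!val_eqE /= => /orP[] /eqP h; congr (_, _); apply/val_inj => /=; lia.
Qed.

Lemma frame_coprime : pairwise (fun b b' => coprime_mnm b.1 b'.1) frame_gens.
Proof.
rewrite pairwise_map.
apply: (sub_in_pairwise (P := mem upper) _ _ upper_pairwise); last exact/allP.
move=> e e' eu e'u /= /andP[_ ne].
apply/forallP => v; rewrite /= !mnmDE !mnm1E !addn_eq0 !eqb0.
have [<-|_] := eqVneq (yv e.1 _) v.
  rewrite !zv_yv yv_eq ?orbF /= ?andbT ?orbF ?andbT.
  by apply: contra ne => /andP[/eqP e1 /eqP ek]; rewrite (@lead_idx_inj e e') ?e1 ?eqxx.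
have [<-|//] := eqVneq (zv e.2 _) v.
rewrite !yv_zv !zv_eq /=.
by apply: contra ne => /andP[/eqP e1 /eqP ek];
  rewrite (@lead_idx_inj e e') ?e1 ?eqxx ?orbT.
Qed.

Lemma frame_radical f k : in_ideal frame_gens (f ^+ k) -> in_ideal frame_gens f.
Proof.
move=> fk; apply: (squarefree_radical weight_gt0 frame_has_lead frame_coprime _ fk).
move=> _ v /mapP[e _ ->] /=; rewrite mnmDE !mnm1E.
by have [<-|_] := eqVneq (yv _ _) v; rewrite ?zv_yv //; case: (_ == _).
Qed.

End SmallRank.

(** * Primality and complete integral closedness for N < m *)

Section LargerRank.
Hypothesis Nm : (N < m)%N.
Let Nm' : (N <= m)%N := ltnW Nm.

Lemma tail_idxE e : e \in upper -> tail_idx e = (e.2 - e.1).+1 :> nat.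
Proof. by move=> _; rewrite inordK //; have := ltn_ord e.2; lia. Qed.

Lemma lead_neq_tail e : e \in upper -> lead_idx e != tail_idx e.
Proof.
by move=> eu; rewrite -val_eqE /= lead_idxE // tail_idxE //; lia.
Qed.

Lemma frame_triangular : triangular (map rule_of upper).
Proof.
apply/andP; split.
  apply/allP => _ /mapP[e eu ->]; rewrite /rule_wf /= !inE !negb_or.
  by rewrite yv_zv yv_eq yv_zv zv_yv zv_eq !eqxx /= (negPf (lead_neq_tail eu)).
rewrite pairwise_map.
apply: (sub_in_pairwise (P := mem upper) _ _ upper_pairwise); last exact/allP.
move=> e e' eu e'u /= /andP[le ne].
have ltt : lead_idx e != tail_idx e'.
  by rewrite -val_eqE /= lead_idxE // tail_idxE //; lia.
rewrite /touched /= !inE !negb_or !yv_zv !zv_yv !yv_eq !zv_eq (negPf ltt) !andbF /= !andbT.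
by apply/andP; split; apply: contra ne => /andP[/eqP e1 /eqP ek];
  rewrite (@lead_idx_inj Nm' e e') ?e1 ?eqxx ?orbT.
Qed.

Lemma tail_weights e : e \in upper ->
  (w (rule_of e).2.1 + w (rule_of e).2.2 < w (rule_of e).1.1 + w (rule_of e).1.2)%N /\
  (D (rule_of e).1.1 + D (rule_of e).1.2 = D (rule_of e).2.1 + D (rule_of e).2.2)%N.
Proof.
move=> eu; split.
  by apply: straight_lt => //; rewrite eq_sym lead_neq_tail.
have le := eu; rewrite mem_upper in le.
rewrite /rule_of !by_block_y !by_block_z lead_idxE // tail_idxE // /Dz.
have := ltn_ord e.2; move: (nat_of_ord e.1) (nat_of_ord e.2) le => i j ij jN.
have jE : j = (i + (j - i))%N by lia.
move: (j - i)%N jE => d jE; subst j.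
have := @weight_straight i d d.+1 ltac:(lia) ltac:(lia).
have := @weight_straight i d d ltac:(lia) ltac:(lia).
move: (wy _ _) (wy _ _) (wz _ _) (wz _ _) => x y x' y'.
rewrite -!mulnA !(mulnS, mulSn); move: (m' * m')%N => M.
by move: (d * d)%N => s; lia.
Qed.

(** The deficit is (k - d)(k - d - 1) with d = j - i, positive at every integer k other than d and d
    + 1. *)
Lemma straightD_lt e k : e \in upper -> k != lead_idx e -> k != tail_idx e ->
  (D (yv e.1 k) + D (zv e.2 k) < D (rule_of e).1.1 + D (rule_of e).1.2)%N.
Proof.
move=> eu; have le := eu; rewrite mem_upper in le.
rewrite /rule_of !by_block_y !by_block_z -!val_eqE /= lead_idxE // tail_idxE // /Dz.
have := ltn_ord k; have := ltn_ord e.2.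
move: (nat_of_ord e.1) (nat_of_ord e.2) (nat_of_ord k) le => i j l ij jN lm.
have jE : j = (i + (j - i))%N by lia.
move: (j - i)%N jE => d jE; subst j => ld ld'.
have := @weight_straight i d l ltac:(lia) ltac:(lia).
have := @weight_straight i d d ltac:(lia) ltac:(lia).
have : (2 * (d * l) + l < d * d + d + l * l)%N.
  have [lt|gt] : (l < d)%N \/ (d.+1 < l)%N by lia.
    by rewrite -(subnKC (ltnW lt)); move: (d - l)%N (subn_gt0 l d) => t;
      rewrite lt; nia.
  by rewrite -(subnKC (ltnW gt)); move: (l - d.+1)%N (subn_gt0 d.+1 l) => t;
    rewrite gt; nia.
move: (wy _ _) (wy _ _) (wz _ _) (wz _ _) => x y x' y'; rewrite -!mulnA.
move: (m * m)%N => M.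
by move: (d * d)%N (l * l)%N (d * l)%N => s t r; lia.
Qed.

(** Alternating in k, so that consecutive products y_ik z_jk get opposite scalars and the binomials
    map to 0. *)
Definition sign_of : 'I_V -> K := by_block (fun _ k => (-1) ^+ k) (fun _ _ => 1).

Definition lower_terms (e : 'I_N * 'I_N) :=
  [seq (yv e.1 k, zv e.2 k) | k <- enum 'I_m & (k != lead_idx e) && (k != tail_idx e)]
    ++ cross e.

Let sign_neq0 v : sign_of v != 0.
Proof.
by elim/block_ind: v => i k; rewrite /sign_of ?by_block_y ?by_block_z ?signr_eq0 ?oner_eq0.
Qed.

Let sign_bal e : e \in upper ->
  sign_of (rule_of e).1.1 * sign_of (rule_of e).1.2 =
  - (sign_of (rule_of e).2.1 * sign_of (rule_of e).2.2).
Proof.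
move=> eu; rewrite /sign_of /rule_of !by_block_y !by_block_z !mulr1.
by rewrite lead_idxE // tail_idxE // exprS mulN1r opprK.
Qed.

Let frame_genE e : e \in upper -> frame_gen e =
  'X_((rule_of e).1.1) * 'X_((rule_of e).1.2) +
  ('X_((rule_of e).2.1) * 'X_((rule_of e).2.2) +
   \sum_(p <- lower_terms e) 'X_(p.1) * 'X_(p.2)).
Proof.
move=> eu; rewrite /frame_gen (bigD1 (lead_idx e)) //= (bigD1 (tail_idx e)) /=;
  last first.
  by rewrite eq_sym lead_neq_tail.
by rewrite -!addrA -cross_sum big_cat /= big_map big_filter big_enum_cond.
Qed.

Let lower_lt e p : e \in upper -> p \in lower_terms e ->
  (w p.1 + w p.2 < w (rule_of e).1.1 + w (rule_of e).1.2)%N /\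
  (D p.1 + D p.2 < D (rule_of e).1.1 + D (rule_of e).1.2)%N.
Proof.
move=> eu; rewrite mem_cat => /orP[/mapP[k]|/(cross_lt Nm' eu)//].
rewrite mem_filter => /andP[/andP[kl kt] _] -> /=.
by split; [exact: straight_lt|exact: straightD_lt].
Qed.

Let bal e : e \in upper ->
  (D (rule_of e).1.1 + D (rule_of e).1.2 = D (rule_of e).2.1 + D (rule_of e).2.2)%N.
Proof. by move=> /tail_weights[]. Qed.

Let tail_lt e : e \in upper ->
  (w (rule_of e).2.1 + w (rule_of e).2.2 < w (rule_of e).1.1 + w (rule_of e).1.2)%N.
Proof. by move=> /tail_weights[]. Qed.

Lemma frame_prime f f' :
  in_ideal frame_gens (f * f') -> in_ideal frame_gens f \/ in_ideal frame_gens f'.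
Proof.
exact: (toric_prime frame_triangular weight_gt0 weightD_gt0 sign_neq0 bal
  tail_lt sign_bal frame_genE lower_lt).
Qed.

Lemma frame_almost_integral a b x :
    ~ in_ideal frame_gens b -> ~ in_ideal frame_gens x ->
    (forall k, exists y, in_ideal frame_gens (x * a ^+ k - b ^+ k * y)) ->
  exists d, in_ideal frame_gens (a - b * d).
Proof.
exact: (toric_almost_integral frame_triangular weight_gt0 weightD_gt0 sign_neq0 bal
  tail_lt sign_bal frame_genE lower_lt).
Qed.

End LargerRank.

End IsotropicFrames.

(** * The moment ideal as the frame ideal *)

Lemma ideal_gen_in_ideal n (K : fieldType) (B : seq ('X_{1..n} * {mpoly K[n]}))
    (G : {mpoly K[n]} -> Prop) f :
    (forall b, b \in B -> ideal_gen G b.2) -> (forall g, G g -> in_ideal B g) ->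
  in_ideal B f <-> ideal_gen G f.
Proof.
move=> BG GB; split=> [|[s [Gs ->]]]; last first.
  rewrite big_seq; elim/big_ind: _ => [|p q|q /Gs/GB]; first exact: in_ideal0.
    exact: in_idealD.
  exact: in_idealMl.
elim: B f BG {GB} => [|b B IH] f BG /=; first by move=> ->; exact: ideal_gen0.
move=> [h /IH fh]; rewrite -(subrK (h * b.2) f); apply: ideal_genD.
  by apply: fh => b' b'B; apply: BG; rewrite inE b'B orbT.
by apply/ideal_genMl/BG; rewrite mem_head.
Qed.

Lemma moment_idealE n m' (K : fieldType) (f : coord_ring n m'.+1 K) :
  (2 != 0 :> K) ->
  f \in @moment_ideal n m'.+1 K <-> in_ideal (frame_gens (n + n) m' K) f.
Proof.
move=> K2; rewrite moment_ideal_entries //; set M := _ *m _ *m _.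
pose y i k : coord_ring n m'.+1 K := 'X_(@yv (n + n) m' i k).
pose z i k : coord_ring n m'.+1 K := 'X_(@zv (n + n) m' i k).
have ME i j : M i j = \sum_k y i k * z j k + \sum_k y j k * z i k.
  rewrite /M mulmx_symQ !mxE addrC; congr (_ + _); apply: eq_bigr => k _;
    by rewrite !mxE // mulrC.
have Msym i j : M i j = M j i by rewrite !ME addrC.
have Mdiag i : M i i = 2%:MP * frame_gen m' K (i, i).
  by rewrite ME /frame_gen eqxx addr0 -mulr2n mul_mpolyC scaler_nat.
have Moff i j : i != j -> M i j = frame_gen m' K (i, j).
  by move=> ij; rewrite ME /frame_gen /= (negPf ij).
symmetry; apply: ideal_gen_in_ideal => [_ /mapP[[i j] _ ->]|_ [i [j ->]]] /=.
  have [<-|ij] := eqVneq i j; last first.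
    by rewrite -Moff //; apply: ideal_gen_mem; exists i, j.
  have -> : frame_gen m' K (i, i) = (2^-1)%:MP * M i i.
    by rewrite Mdiag mulrA -mpolyCM mulVf // mpolyC1 mul1r.
  by apply/ideal_genMl/ideal_gen_mem; exists i, i.
wlog le : i j / (i <= j)%N.
  by move=> H; case: (leqP i j) => [|/ltnW] /H //; rewrite Msym.
have gen : in_ideal (frame_gens (n + n) m' K) (frame_gen m' K (i, j)).
  have iju : (i, j) \in upper (n + n) by rewrite mem_upper.
  exact: (in_ideal_mem (map_f (fun e => (_, frame_gen m' K e)) iju)).
have [ij|ij] := eqVneq i j; last by rewrite Moff.
by rewrite -ij in gen *; rewrite Mdiag; exact: in_idealMl.
Qed.

(** * From complete integral closedness to normal local rings *)

Section ClassicalDomain.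
Variable B : comNzRingType.
Hypothesis domB : forall x y : B, x * y = 0 -> x = 0 \/ y = 0.

(* [B] with classically chosen inverses.                                      *)
Definition domain_of (_ : forall x y : B, x * y = 0 -> x = 0 \/ y = 0) : Type := B.
Local Notation D := (domain_of domB).

HB.instance Definition _ := GRing.ComNzRing.copy D B.

Definition dom_unit : {pred D} := fun x => `[< exists y : D, y * x = 1 >].

Definition dom_inv (x : D) : D :=
  if pselect (exists y : D, y * x = 1) is left e then projT1 (cid e) else x.

Lemma dom_mulVx : {in dom_unit, left_inverse 1 dom_inv *%R}.
Proof.
by move=> x /asboolP xu; rewrite /dom_inv; case: pselect => // e; case: cid.
Qed.

Lemma dom_unitPl (x y : D) : y * x = 1 -> dom_unit x.
Proof. by move=> yx; apply/asboolP; exists y. Qed.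

Lemma dom_invr_out : {in [predC dom_unit], dom_inv =1 id}.
Proof.
by move=> x /negP xu; rewrite /dom_inv; case: pselect => // e; case: xu; apply/asboolP.
Qed.

HB.instance Definition _ := GRing.ComNzRing_hasMulInverse.Build D
  dom_mulVx dom_unitPl dom_invr_out.

Lemma dom_integral : GRing.integral_domain_axiom D.
Proof. by move=> x y /domB[]->; rewrite eqxx ?orbT. Qed.

HB.instance Definition _ := GRing.ComUnitRing_isIntegral.Build D dom_integral.

End ClassicalDomain.

Lemma frac_repr (D : idomainType) (z : {fraction D}) :
  exists2 y : D, y != 0 & exists x : D, z * FracField.tofrac y = FracField.tofrac x.
Proof.
elim/quotW: z => r; exists \d_r; first exact: denom_ratioP.
exists \n_r; unlock FracField.tofrac; rewrite -[LHS]FracField.pi_mul.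
apply/eqmodP => /=; rewrite /FracField.equivf /FracField.mulf.
by rewrite !numden_Ratio ?mulr1 ?oner_neq0 ?denom_ratioP // mulrC.
Qed.

(** Integral closedness with cleared denominators: the equation says that x/y is integral. *)
Definition divides_integral (B : comNzRingType) :=
  forall (k : nat) (c : nat -> B) (x y : B), y <> 0 ->
    x ^+ k = \sum_(i < k) c i * x ^+ i * y ^+ (k - i) -> exists d, x = d * y.

Lemma normal_domainP (B : comNzRingType) :
    (forall x y : B, x * y = 0 -> x = 0 \/ y = 0) -> divides_integral B ->
  normal_domain B.
Proof.
move=> domB icB; pose D : idomainType := domain_of domB.
exists D, (idfun : {rmorphism B -> D}); split; first by exists idfun.
move=> z [p /monicP p1 /rootP pz].
have [y y0 [x zy]] := frac_repr z.
pose k := (size p).-1; have kE : size p = k.+1.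
  rewrite prednK // lt0n size_poly_eq0; apply: contra_eq_neq p1 => ->.
  by rewrite lead_coef0 eq_sym oner_eq0.
have xk : x ^+ k = \sum_(i < k) (- p`_i) * x ^+ i * y ^+ (k - i).
  apply/eqP; rewrite -tofrac_eq rmorphXn rmorph_sum /= -zy exprMn.
  move: pz; rewrite (@horner_coef_wide _ k.+1) -?kE ?size_poly // kE big_ord_recr /=.
  rewrite coef_map /= -/(lead_coef p) p1 rmorph1 mul1r => /eqP.
  rewrite addrC addr_eq0 => /eqP ->; rewrite mulNr mulr_suml -sumrN.
  apply/eqP/eq_bigr => i _; rewrite coef_map /= !(rmorphM, rmorphN, rmorphXn) /= -zy.
  have -> : FracField.tofrac y ^+ k =
      FracField.tofrac y ^+ i * FracField.tofrac y ^+ (k - i).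
    by rewrite -exprD subnKC // ltnW.
  by rewrite exprMn; ring.
have [d xE] := icB k (fun i => - p`_i) x y (elimN eqP y0) xk.
exists d; apply: (mulIf (x := FracField.tofrac y)); first by rewrite tofrac_eq0.
by rewrite zy -tofracM xE.
Qed.

Section AlmostIntegral.
Variable A : comNzRingType.
Hypothesis domA : forall a b : A, a * b = 0 -> a = 0 \/ b = 0.
Hypothesis cicA : forall a b x : A, b <> 0 -> x <> 0 ->
  (forall k, exists y, x * a ^+ k = b ^+ k * y) -> exists d, a = b * d.

(* If a/b is integral of degree k over A, then b^k A contains b^k (a/b)^j for  *)
(* all j, so a/b is almost integral.                                          *)
Lemma almost_integral_divides : divides_integral A.
Proof.
move=> k c a b b0 ak.
have bk0 : b ^+ k <> 0.
  elim: k {c ak} => [|k IH]; first by apply/eqP; rewrite expr0 oner_neq0.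
  by rewrite exprS => /domA[].
have [|d ->] := cicA b0 bk0 (a := a); last by exists d; rewrite mulrC.
elim/ltn_ind => j IH; have [jk|kj] := ltnP j k.
  by exists (b ^+ (k - j) * a ^+ j); rewrite mulrA -exprD subnKC // ltnW.
(* For j >= k the integral equation expresses a^j through the powers a^(j - k + i) with i < k, all
   lower than j. *)
have /choice[e eP] : forall i : 'I_k,
    exists y, b ^+ k * a ^+ (j - k + i) = b ^+ (j - k + i) * y.
  by move=> i; apply: IH; have := ltn_ord i; lia.
exists (\sum_(i < k) c i * e i).
rewrite -{1}(subnK kj) exprD ak !mulr_sumr; apply: eq_bigr => i _.
have -> : b ^+ j = b ^+ (k - i) * b ^+ (j - k + i).
  by rewrite -exprD; congr (_ ^+ _); have := ltn_ord i; lia.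
rewrite [RHS](_ : _ = c i * b ^+ (k - i) * (b ^+ (j - k + i) * e i)); last by ring.
by rewrite -eP exprD; ring.
Qed.

Variable p : prime_idealr A.
Local Notation L := (localization p).

Definition to_loc (a : A) : L := \pi_L (Localization.fracA p a).

Let fracE := (Localization.num_mk, Localization.den_mk).

Lemma to_loc_zmod : zmod_morphism to_loc.
Proof.
move=> a b; rewrite -[RHS]/(Localization.add (to_loc a) (Localization.opp (to_loc b))) !piE.
by apply: Localization.eq_by; rewrite !fracE; ring.
Qed.

Lemma to_loc_monoid : monoid_morphism to_loc.
Proof.
split=> [|a b]; first by rewrite -[RHS]/(Localization.one p) !piE.
rewrite -[RHS]/(Localization.mul (to_loc a) (to_loc b)) !piE.
by apply: Localization.eq_by; rewrite !fracE; ring.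
Qed.

HB.instance Definition _ := GRing.isZmodMorphism.Build A L to_loc to_loc_zmod.
HB.instance Definition _ := GRing.isMonoidMorphism.Build A L to_loc to_loc_monoid.

Lemma to_loc_repr (x : L) :
  exists2 s, s \notin (p : {pred A}) & exists a, x * to_loc s = to_loc a.
Proof.
elim/quotW: x => x; exists (Localization.den x); first exact: Localization.denP.
exists (Localization.num x); rewrite /to_loc -[LHS]Localization.pi_mul.
by apply: Localization.eq_by; rewrite !fracE; ring.
Qed.

Lemma to_loc_unit s : s \notin (p : {pred A}) -> exists t, to_loc s * t = 1.
Proof.
move=> ps; exists (\pi_L (Localization.mk 1 ps)).
rewrite -(rmorph1 to_loc) /= /to_loc -[LHS]Localization.pi_mul.
by apply: Localization.eq_by; rewrite !fracE; ring.
Qed.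

Lemma to_loc_inj : injective to_loc.
Proof.
apply/raddf_inj => a; rewrite -(rmorph0 to_loc) => /eqP/Localization.piP[u pu].
rewrite !fracE !mulr1 subr0 => /domA[u0|//].
by rewrite u0 rpred0 in pu.
Qed.

Lemma to_loc_cancel s x y :
  s \notin (p : {pred A}) -> x * to_loc s = y * to_loc s -> x = y.
Proof.
move=> /to_loc_unit[t st] /(congr1 (fun z => z * t)).
by rewrite -!mulrA st !mulr1.
Qed.

Lemma loc_domain (x y : L) : x * y = 0 -> x = 0 \/ y = 0.
Proof.
move=> xy0; have [s ps [a xa]] := to_loc_repr x; have [t pt [b yb]] := to_loc_repr y.
have : to_loc (a * b) = to_loc 0.
  by rewrite rmorphM rmorph0 /= -xa -yb mulrACA xy0 mul0r.
move=> /to_loc_inj/domA[a0|b0]; [left|right].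
  by apply: (to_loc_cancel ps); rewrite xa a0 rmorph0 mul0r.
by apply: (to_loc_cancel pt); rewrite yb b0 rmorph0 mul0r.
Qed.

Lemma common_denominator (c : nat -> L) k :
  exists2 t, t \notin (p : {pred A}) &
    exists c' : nat -> A, forall i, (i < k)%N -> c i * to_loc t = to_loc (c' i).
Proof.
elim: k => [|k [t pt [c' tc]]].
  by exists 1; [rewrite idealr1|exists (fun=> 0)].
have [s ps [a sa]] := to_loc_repr (c k).
exists (t * s); first exact: Localization.notinM.
exists (fun i => if i == k then t * a else c' i * s) => i; rewrite ltnS leq_eqVlt.
have [->|_ /= /tc ci] := eqVneq i k; first by rewrite !rmorphM /= -sa mulrCA.
by rewrite !rmorphM /= mulrA ci.
Qed.

Lemma loc_normal_domain : normal_domain L.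
Proof.
apply: normal_domainP loc_domain _ => k c x y y0 xk.
have [s1 ps1 [a1 xa1]] := to_loc_repr x; have [s2 ps2 [b1 yb1]] := to_loc_repr y.
have [t pt [c' tc]] := common_denominator c k.
pose s := s1 * s2; pose a := a1 * s2; pose b := b1 * s1.
have ps : s \notin (p : {pred A}) by exact: Localization.notinM.
have xa : x * to_loc s = to_loc a by rewrite !rmorphM /= -xa1 mulrA.
have yb : y * to_loc s = to_loc b by rewrite !rmorphM /= -yb1 -mulrA [to_loc s2 * _]mulrC.
clearbody s a b; have b0 : b <> 0.
  move=> b0; apply: y0; apply: (to_loc_cancel ps).
  by rewrite yb b0 rmorph0 mul0r.
(* Multiplying the equation of a/b by t^k gives one for at/b with coefficients c_i t^(k - i); one
   factor t clears the denominator of c_i. *)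
have [|d atE] := @almost_integral_divides k (fun i => c' i * t ^+ (k - i.+1)) (a * t) b b0.
  apply: to_loc_inj; rewrite [LHS]rmorphXn [RHS]rmorph_sum /= rmorphM /= -xa.
  rewrite 2!exprMn xk !mulr_suml.
  apply: eq_bigr => i _; rewrite !(rmorphM, rmorphXn) /= -tc // -xa -yb !exprMn.
  have -> : to_loc s ^+ k = to_loc s ^+ i * to_loc s ^+ (k - i).
    by rewrite -exprD subnKC // ltnW.
  have -> : to_loc t ^+ k = to_loc t * to_loc t ^+ i * to_loc t ^+ (k - i.+1).
    by rewrite -exprS -exprD subnKC.
  by ring.
have [t' tt'] := to_loc_unit pt.
exists (t' * to_loc d); apply: (to_loc_cancel ps).
have := congr1 to_loc atE; rewrite !rmorphM /= -xa -yb => xE.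
rewrite -[x * _]mulr1 -tt' mulrA xE; ring.
Qed.

End AlmostIntegral.

(** * Transfer to the coordinate ring of the zero fibre *)

Section ZeroFibreQuotient.
Variables (n m' : nat) (K : fieldType).
Hypothesis K2 : (2 != 0 :> K).
Local Notation A := (zero_fibre n m'.+1 K).
Local Notation I := (in_ideal (frame_gens (n + n) m' K)).

Lemma pi_eq0 (f : coord_ring n m'.+1 K) : \pi_A f = 0 <-> I f.
Proof.
rewrite -(moment_idealE _ K2).
have -> : (f \in @moment_ideal n m'.+1 K) = (f - 0 \in @moment_ideal n m'.+1 K).
  by rewrite subr0.
by rewrite Quotient.idealrBE -(rmorph0 (\pi_A)); split=> [->|/eqP].
Qed.

Lemma zero_fibre_reduced : (n + n <= m'.+1)%N -> reduced_ring A.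
Proof.
move=> le a k; elim/quotW: a => f; rewrite -rmorphXn => /pi_eq0/(frame_radical le).
by move=> /pi_eq0.
Qed.

Lemma zero_fibre_normal : (n + n < m'.+1)%N -> normal_spec A.
Proof.
move=> lt p; apply: loc_normal_domain => [|a b x].
  elim/quotW=> f; elim/quotW=> g; rewrite -rmorphM => /pi_eq0/(frame_prime lt).
  by case=> /pi_eq0; [left|right].
elim/quotW: a => a; elim/quotW: b => b; elim/quotW: x => x b0 x0 H.
have [||k|d] := @frame_almost_integral _ _ K lt a b x.
- by move=> /pi_eq0.
- by move=> /pi_eq0.
- have [y] := H k; elim/quotW: y => y e; exists y; apply/pi_eq0.
  by rewrite rmorphB !rmorphM !rmorphXn /= e subrr.
move=> /pi_eq0; rewrite rmorphB rmorphM /= => /eqP; rewrite subr_eq0 => /eqP ->.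
by exists (\pi_A d).
Qed.

End ZeroFibreQuotient.

Theorem theorem1p3 (R : realType) (n m : nat) (hn : (1 <= n)%N) (hm : (1 <= m)%N) :
  ((2 * n <= m)%N -> reduced_ring (zero_fibre n m R[i])) /\
  ((2 * n + 1 <= m)%N -> normal_spec (zero_fibre n m R[i])).
Proof.
have two : (2 != 0 :> R[i]) by rewrite Num.Theory.pnatr_eq0.
case: m hm => // m' _; rewrite mul2n -addnn addn1.
by split; [exact: zero_fibre_reduced | exact: zero_fibre_normal].
Qed.
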